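(* Let $\{S(t): t\ge 0\}$ be a semigroup on a nonempty closed subset $V$ of a Banach space $(X,\|\cdot\|_X)$ over $\mathbb{K}\in\{\mathbb{R},\mathbb{C}\}$ and $\mathbf{B}\subseteq V$ be a bounded absorbing set for the semigroup. Moreover, let $\{S(t): t\ge 0\}$ be asymptotically closed or $\mathbf{B}$ be closed. If the semigroup satisfies the generalized squeezing property on $\mathbf{B}$ at time $T>0$ with parameters $(n,\eta,\mu,\kappa)$ (with associated map $P:V\to X_n$), then for any $\sigma\in(0,1-\eta)$ there exists a $T$-discrete exponential attractor $\mathbf{M_0}\subseteq\mathbf{B}$ for the semigroup and $$\dim_f^{V}(\mathbf{M_0})\le\mathbf{n}\log_{\frac{1}{\eta+\sigma}}\left(1+\tfrac{2\kappa\mu\, d_{BM}(X_n,\ell^n_2)}{\sigma}\right),$$ where $\mathbf{n}=n$ if $\mathbb{K}=\mathbb{R}$ and $\mathbf{n}=2n$ if $\mathbb{K}=\mathbb{C}$. If the semigroup is asymptotically closed, then it has a global attractor $\mathbf{A}$ contained in $\mathbf{M_0}$.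
   Context: $V$ carries the metric $d(x,y)=\|x-y\|_X$. A semigroup $\{S(t):t\ge0\}$ on $V$ is a family of (not necessarily linear) maps $S(t):V\to V$ with $S(t)S(s)=S(t+s)$ for $t,s\ge 0$ and $S(0)=I$; ''$t\ge 0$'' means throughout either $t\in[0,\infty)$ or $t\in\mathbb{N}_0=\{0,1,2,\dots\}$ (and $T$ belongs to the time set). Generalized squeezing property on $B\subseteq V$ at time $T>0$ with parameters $(n,\eta,\mu,\kappa)$: there exist a map $P:V\to X_n$ (possibly nonlinear) with values in a normed space $(X_n,\|\cdot\|_{X_n})$ over $\mathbb{K}$ of dimension $n\in\mathbb{N}=\{1,2,\dots\}$ and constants $\eta\in[0,1)$, $\mu>0$, $\kappa>0$ such that for all $x,y\in B$ $$\|S(T)x-S(T)y\|_X\le\eta\|x-y\|_X+\mu\|PS(T)x-PS(T)y\|_{X_n},\qquad \|PS(T)x-PS(T)y\|_{X_n}\le\kappa\|x-y\|_X.$$ $\ell_2^n$ is $\mathbb{K}^n$ with the Euclidean norm, and $d_{BM}(X_n,\ell^n_2)=\inf\{\|\Lambda\|_{\mathcal{L}(X_n,\ell^n_2)}\|\Lambda^{-1}\|_{\mathcal{L}(\ell^n_2,X_n)}:\Lambda:X_n\to\ell^n_2\text{ a linear isomorphism}\}$. Asymptotically closed: for any $t\ge 0$, $t_k\ge 0$ with $t_k\to\infty$ and any bounded sequence $x_k\in V$, if $S(t_k)x_k\to x$ and $S(t+t_k)x_k\to y$ with $x,y\in V$, then $S(t)x=y$. Absorbing set: $\mathbf{B}\subseteq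 V$ such that for every bounded $G\subseteq V$ there is $t_G\ge 0$ with $S(t)G\subseteq\mathbf{B}$ for all $t\ge t_G$. $\mathrm{dist}^V(G,H)=\sup_{x\in G}\inf_{y\in H}d(x,y)$. $N^V(G,\varepsilon)$ is the minimal number of open $\varepsilon$-balls in $V$ centered at points of $G$ needed to cover $G$; $\dim_f^V(G)=\limsup_{\varepsilon\to0^+}\log_{1/\varepsilon}N^V(G,\varepsilon)$. Global attractor: a nonempty compact set $\mathbf{A}\subseteq V$ with $S(t)\mathbf{A}=\mathbf{A}$ for all $t\ge 0$ and $\lim_{t\to\infty}\mathrm{dist}^V(S(t)G,\mathbf{A})=0$ for every bounded $G\subseteq V$. $T$-discrete exponential attractor: a nonempty compact set $\mathbf{M_0}\subseteq V$ such that $S(T)\mathbf{M_0}\subseteq\mathbf{M_0}$, $\dim_f^V(\mathbf{M_0})<\infty$, and there is $\xi>0$ with $\lim_{t\to\infty}e^{\xi t}\mathrm{dist}^V(S(t)G,\mathbf{M_0})=0$ for every bounded $G\subseteq V$. *)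

(* Defs.v *)
From HB Require Import structures.
From mathcomp Require Import all_boot all_order all_algebra.
From mathcomp Require Import complex.
From mathcomp Require Import all_classical all_reals all_analysis.
Import Order.TTheory GRing.Theory Num.Theory.
Import numFieldNormedType.Exports.

Set Implicit Arguments.
Unset Strict Implicit.
Unset Printing Implicit Defensive.

Local Open Scope classical_set_scope.
Local Open Scope ring_scope.

Variant scalar_kind := RealScalars | ComplexScalars.

Definition scalar_field (R : realType) (k : scalar_kind) : numFieldType :=
  match k with RealScalars => R | ComplexScalars => R[i] end.

Definition real_part (R : realType) (k : scalar_kind) : scalar_field R k -> R :=
  match k return scalar_field R k -> R with
  | RealScalars => fun x => x
  | ComplexScalars => fun z => complex.Re z
  end.

(* The library norm of a normed space over [scalar_field R k] takes its values
   in the nonnegative real elements of [scalar_field R k]; [rnorm] is the same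
   number in R. *)
Definition rnorm (R : realType) (k : scalar_kind)
    (E : normedZmodType (scalar_field R k)) (x : E) : R := real_part `|x|.

Definition real_multiplicity (k : scalar_kind) (n : nat) : nat :=
  match k with RealScalars => n | ComplexScalars => n.*2 end.

Variant time_kind := ContinuousTime | DiscreteTime.

Definition time_set (R : realType) (k : time_kind) : set R :=
  match k with
  | ContinuousTime => [set t | 0 <= t]
  | DiscreteTime => range (fun m : nat => m%:R)
  end.
Arguments time_set R k : clear implicits.

Definition has_dim (F : numFieldType) (n : nat) (E : lmodType F) : Prop :=
  inhabited (Vector.axiom n E).

Definition l2norm (R : realType) (k : scalar_kind) (n : nat)
    (v : 'rV[scalar_field R k]_n) : R :=
  Num.sqrt (\sum_(i < n) rnorm (v ord0 i) ^+ 2).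

(* The real [sup] of an unbounded set is 0; linear maps between
   finite-dimensional spaces, the only use below, are bounded. *)
Definition opnorm (R : realType) (E F : Type) (nE : E -> R) (nF : F -> R)
    (f : E -> F) : R :=
  sup [set nF (f x) | x in [set x | nE x <= 1]].

Definition dBM (R : realType) (k : scalar_kind) (n : nat)
    (E : normedModType (scalar_field R k)) : R :=
  inf [set r | exists (L : {linear E -> 'rV[scalar_field R k]_n})
                      (Li : {linear 'rV[scalar_field R k]_n -> E}),
         [/\ cancel L Li, cancel Li L &
             r = opnorm (@rnorm R k E) (@l2norm R k n) L *
                 opnorm (@l2norm R k n) (@rnorm R k E) Li]].

Section Metric.
Context {R : realType} {k : scalar_kind} {X : normedModType (scalar_field R k)}.
Implicit Types (V G H : set X) (e : R).

Definition metric (x y : X) : R := rnorm (x - y).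

(* The supremum is taken in [0, +oo], hence the [maxe]: it makes
   [semidist set0 H = 0], whereas [ereal_sup set0 = -oo]. *)
Definition semidist G H : \bar R :=
  maxe 0%E (ereal_sup [set ereal_inf [set (metric x y)%:E | y in H] | x in G]).

(* +oo when G has no finite cover *)
Definition covering_number G e : \bar R :=
  ereal_inf [set (size s)%:R%:E | s in
    [set s : seq X | (forall c, c \in s -> G c) /\
                     forall x, G x -> exists2 c, c \in s & metric c x < e]].

Definition fractal_dim G : \bar R :=
  limf_esup (fun e : R => lne (covering_number G e) * ((ln e^-1)^-1)%:E)%E
            (0 : R)^'+.

End Metric.

(* Maps on V are represented by total maps on X whose values outside V (and,
   for S, at times outside I) are never used. Since V is closed in X in the
   theorem, compactness and closedness in V are those in X. *)
Section Semigroup.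
Context {R : realType} {k : scalar_kind} {X : normedModType (scalar_field R k)}.
Variables (I : set R) (V : set X) (S : R -> X -> X).

Definition semigroup : Prop :=
  [/\ forall t x, I t -> V x -> V (S t x),
      forall x, V x -> S 0 x = x &
      forall t s x, I t -> I s -> V x -> S t (S s x) = S (t + s) x].

Definition generalized_squeezing (B : set X) (T : R) (n : nat)
    (eta mu kappa : R) (Xn : normedModType (scalar_field R k))
    (P : X -> Xn) : Prop :=
  [/\ (0 < n)%N /\ has_dim n Xn, 0 <= eta < 1, 0 < mu, 0 < kappa &
      forall x y, B x -> B y ->
        rnorm (S T x - S T y) <=
          eta * rnorm (x - y) + mu * rnorm (P (S T x) - P (S T y)) /\
        rnorm (P (S T x) - P (S T y)) <= kappa * rnorm (x - y)].

Definition asymptotically_closed : Prop :=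
  forall (t : R) (t_ : nat -> R) (x_ : nat -> X) (x y : X),
    I t -> (forall i, I (t_ i)) -> t_ @ \oo --> +oo ->
    (forall i, V (x_ i)) -> bounded_set (range x_) -> V x -> V y ->
    (fun i => S (t_ i) (x_ i)) @ \oo --> x ->
    (fun i => S (t + t_ i) (x_ i)) @ \oo --> y ->
    S t x = y.

Definition absorbing (B : set X) : Prop :=
  B `<=` V /\
  forall G : set X, G `<=` V -> bounded_set G ->
    exists2 tG, I tG & forall t, I t -> tG <= t -> S t @` G `<=` B.

Definition global_attractor (A : set X) : Prop :=
  [/\ A `<=` V, A !=set0, compact A,
      forall t, I t -> S t @` A = A &
      forall G : set X, G `<=` V -> bounded_set G ->
        semidist (S t @` G) A @[t --> within I +oo] --> 0%E].

Definition discrete_exponential_attractor (T : R) (M : set X) : Prop :=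
  [/\ M `<=` V /\ M !=set0, compact M, S T @` M `<=` M,
      (fractal_dim M < +oo)%E &
      exists2 xi : R, 0 < xi &
        forall G : set X, G `<=` V -> bounded_set G ->
          ((expR (xi * t))%:E * semidist (S t @` G) M)%E
            @[t --> within I +oo] --> 0%E].

End Semigroup.

(* Main.v *)
Require Import Defs.
From HB Require Import structures.
From mathcomp Require Import all_boot all_order all_algebra.
From mathcomp Require complex.
From mathcomp Require Import ring lra.
From mathcomp Require Import all_classical all_reals all_analysis.
Import Order.TTheory GRing.Theory Num.Theory.
Import numFieldNormedType.Exports.
Local Open Scope classical_set_scope.
Local Open Scope ring_scope.

Set Implicit Arguments.
Unset Strict Implicit.
Unset Printing Implicit Defensive.

(* Packing: [m] points that are pairwise [eps]-separated in a set of diameter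
   at most [D] of an [N]-dimensional real normed space satisfy
   [m <= (1 + D / eps) ^ N].  Applied to the values of [P \o S T] on a subset
   [A] of [B] of diameter at most [d], with [D = kappa d] and
   [eps = sigma d / (2 mu)], it splits [S T A] into at most
   [Q = (1 + 2 kappa mu / sigma) ^ N] sets of diameter at most
   [(eta + sigma) d].  The Banach-Mazur distance enters the final bound only
   through [dBM >= 1].

   Iterating on the points of [B] whose [T]-orbit stays in [B] (a forward
   invariant set that is still absorbing) gives, for every [j], a net of at most
   [Q ^ j] points of [S (j T) B] with mesh [(eta + sigma) ^ j d].  The attractor
   is the omega-limit set together with the forward orbits of all these nets:
   up to polynomial factors, [Q ^ j] balls of radius [(eta + sigma) ^ j d] cover
   it.  If the semigroup is asymptotically closed, the omega-limit set is
   invariant, hence contained in [B], and it is the global attractor. *)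

(** * Norms over real or complex scalars *)

Definition of_real (R : realType) (k : scalar_kind) : R -> scalar_field R k :=
  match k return R -> scalar_field R k with
  | RealScalars => fun x => x
  | ComplexScalars => fun x => complex.real_complex R x
  end.
Arguments of_real {R} k _.

Section Scalars.
Import complex.
Variables (R : realType) (k : scalar_kind).
Implicit Types a b : R.

Lemma of_realD a b : of_real k (a + b) = of_real k a + of_real k b.
Proof. by case: k => //=; rewrite rmorphD. Qed.

Lemma of_realM a b : of_real k (a * b) = of_real k a * of_real k b.
Proof. by case: k => //=; rewrite rmorphM. Qed.

Lemma of_realN a : of_real k (- a) = - of_real k a.
Proof. by case: k => //=; rewrite rmorphN. Qed.

Lemma of_real0 : of_real k (0 : R) = 0.
Proof. by case: k. Qed.

Lemma of_real1 : of_real k (1 : R) = 1.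
Proof. by case: k. Qed.

Lemma ler_of_real a b : (of_real k a <= of_real k b) = (a <= b).
Proof. by case: k => //=; rewrite lecR. Qed.

Lemma ltr_of_real a b : (of_real k a < of_real k b) = (a < b).
Proof. by case: k => //=; rewrite ltcR. Qed.

Lemma normr_of_real a : `|of_real k a| = of_real k `|a|.
Proof. by case: k => //=; rewrite normc_def /= expr0n addr0 sqrtr_sqr. Qed.

Lemma of_realK : cancel (of_real k) (@real_part R k).
Proof. by case: k. Qed.

Lemma real_partK (z : scalar_field R k) :
  z \is Num.real -> of_real k (real_part z) = z.
Proof. by case: k z => //= z /RRe_real. Qed.

End Scalars.

Section NormedGroup.
Variables (R : realType) (k : scalar_kind) (E : normedZmodType (scalar_field R k)).
Implicit Types (x y z : E).

Lemma of_real_rnorm x : of_real k (rnorm x) = `|x|.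
Proof. by apply: real_partK; exact: normr_real. Qed.

Lemma rnorm_ge0 x : 0 <= rnorm x.
Proof. by rewrite -(ler_of_real k) of_real_rnorm of_real0. Qed.

Lemma rnorm0 : rnorm (0 : E) = 0.
Proof. by rewrite /rnorm normr0 -(of_real0 R k) of_realK. Qed.

Lemma rnorm_eq0 x : rnorm x = 0 -> x = 0.
Proof.
by move=> x0; apply/normr0_eq0; rewrite -of_real_rnorm x0 of_real0.
Qed.

Lemma ler_rnormD x y : rnorm (x + y) <= rnorm x + rnorm y.
Proof. by rewrite -(ler_of_real k) of_realD !of_real_rnorm ler_normD. Qed.

Lemma rnormN x : rnorm (- x) = rnorm x.
Proof. by rewrite /rnorm normrN. Qed.

Lemma rdistC x y : rnorm (x - y) = rnorm (y - x).
Proof. by rewrite -rnormN opprB. Qed.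

Lemma rdist0 x : rnorm (x - x) = 0.
Proof. by rewrite subrr rnorm0. Qed.

Lemma ler_rdistD z x y : rnorm (x - y) <= rnorm (x - z) + rnorm (z - y).
Proof. by apply: le_trans (ler_rnormD _ _); rewrite addrA subrK. Qed.

End NormedGroup.

Section Norm.
Variables (R : realType) (k : scalar_kind) (E : normedModType (scalar_field R k)).
Implicit Types (x y z : E) (a r : R) (A : set E).

Lemma rnormZ (c : scalar_field R k) x : rnorm (c *: x) = rnorm c * rnorm x.
Proof.
by rewrite [LHS]/rnorm normrZ -(of_real_rnorm c) -of_real_rnorm -of_realM
  of_realK.
Qed.

Lemma rnormM (c d : scalar_field R k) : rnorm (c * d) = rnorm c * rnorm d.
Proof.
by rewrite [LHS]/rnorm normrM -(of_real_rnorm c) -of_real_rnorm -of_realM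
  of_realK.
Qed.

Lemma rnorm_of_real a : rnorm (of_real k a : scalar_field R k) = `|a|.
Proof. by rewrite /rnorm normr_of_real of_realK. Qed.

Lemma bounded_setP A : bounded_set A <-> exists r, forall x, A x -> rnorm x <= r.
Proof.
split=> [[M [Mr AM]]|[r Ar]].
  exists (real_part M + 1) => x Ax.
  rewrite -(ler_of_real k) of_real_rnorm; apply: AM => //.
  by rewrite -{1}(real_partK Mr) ltr_of_real ltrDl.
exists (of_real k r); split.
  by rewrite realE -!(of_real0 R k) !ler_of_real le_total.
move=> M rM x Ax; apply: le_trans (ltW rM).
by rewrite -of_real_rnorm ler_of_real; exact: Ar.
Qed.

(** Library radii live in [scalar_field R k]; a positive one is real, so balls with radii in [R]
    generate the same neighbourhoods. *)
Lemma nbhs_rnormP x A :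
  nbhs x A <-> exists2 e, 0 < e & forall y, rnorm (x - y) < e -> A y.
Proof.
split=> [/nbhs_normP[e /= e0 eA]|[e e0 eA]].
  have er : e \is Num.real by apply: gtr0_real.
  exists (real_part e).
    by rewrite -(ltr_of_real k) of_real0 (real_partK er).
  move=> y xy; apply: eA => /=.
  by rewrite -(real_partK er) -of_real_rnorm ltr_of_real.
apply/nbhs_normP; exists (of_real k e) => /=.
  by rewrite -(of_real0 R k) ltr_of_real.
by move=> y /=; rewrite -of_real_rnorm ltr_of_real => /eA.
Qed.

Lemma closure_rnormP x A :
  closure A x <-> forall e, 0 < e -> exists2 y, A y & rnorm (x - y) < e.
Proof.
split=> [cAx e e0|cAx U /nbhs_rnormP[e e0 eU]].
  have [|y [Ay xy]] := cAx [set y | rnorm (x - y) < e].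
    by apply/nbhs_rnormP; exists e.
  by exists y.
by have [y Ay /eU Uy] := cAx _ e0; exists y.
Qed.

Lemma cvg_rnormP (u : nat -> E) x :
  u @ \oo --> x <-> forall e, 0 < e -> \forall i \near \oo, rnorm (x - u i) < e.
Proof.
split=> [ux e e0|ux U /nbhs_rnormP[e e0 eU]].
  by apply: (ux [set y | rnorm (x - y) < e]); apply/nbhs_rnormP; exists e.
by have := ux _ e0; apply: filterS => i /eU.
Qed.

End Norm.

Lemma cauchy_rnormP (R : realType) (k : scalar_kind)
    (E : completeNormedModType (scalar_field R k)) (F : set_system E) :
  ProperFilter F ->
  (forall e : R, 0 < e -> exists x : E, F [set y | rnorm (x - y) < e]) ->
  exists x : E, F --> x.
Proof.
move=> FF Fe.
suff : cauchy F by move=> /cauchy_cvg Fcvg; exists (lim F).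
apply: cauchy_exP => e e0.
have er : e \is Num.real by apply: gtr0_real.
have [|x Fx] := Fe (real_part e).
  by rewrite -(ltr_of_real k) of_real0 (real_partK er).
exists x; apply: filterS Fx => y /= xy; rewrite -ball_normE /=.
by rewrite -(real_partK er) -of_real_rnorm ltr_of_real.
Qed.

(** * Packing in a finite-dimensional real space *)

(** If [a > 1], Bernoulli's inequality makes the powers grow at least linearly with slope [a - 1],
    so they pass [M] once [j > M / (a - 1)]. *)
Lemma bounded_exprn_le1 (R : realType) (a M : R) :
  (forall j : nat, a ^+ j <= M) -> a <= 1.
Proof.
move=> aM; rewrite leNgt; apply/negP => a1.
have bernoulli (j : nat) : 1 + (a - 1) * j%:R <= a ^+ j.
  elim: j => [|j IHj]; first by rewrite mulr0 addr0 expr0.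
  rewrite exprS -natr1.
  apply: le_trans (ler_wpM2l _ IHj); last lra.
  rewrite -subr_ge0.
  rewrite (_ : _ - _ = (a - 1) ^+ 2 * j%:R); last by ring.
  by rewrite mulr_ge0 ?sqr_ge0.
have a10 : 0 < a - 1 by rewrite subr_gt0.
have := aM (Num.truncn (M / (a - 1))).+1.
have := bernoulli (Num.truncn (M / (a - 1))).+1.
have := truncnS_gt (M / (a - 1)); rewrite ltr_pdivrMr// [_ * (a - 1)]mulrC.
lra.
Qed.

(** Pigeonhole on a grid of side [h]: two points with the same integer cell differ by less than [h]
    in every coordinate, so each of the [(L + 1) ^ N] cells receives at most one point. *)
Lemma card_grid_separated (R : realType) (N : nat) (W : finType)
    (p : W -> 'rV[R]_N) (rho h : R) :
  0 <= rho -> 0 < h -> (forall w i, `|p w ord0 i| <= rho) ->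
  (forall w w', w != w' -> exists i, h <= `|p w ord0 i - p w' ord0 i|) ->
  #|W|%:R <= (2 * rho / h + 1) ^+ N.
Proof.
move=> rho0 h0 prho psep; pose L := Num.truncn (2 * rho / h).
pose z w i := (p w ord0 i + rho) / h.
have z0 w i : 0 <= z w i.
  rewrite divr_ge0 ?(ltW h0)// -lerBlDr sub0r.
  by have := prho w i; rewrite ler_norml => /andP[].
have zL w i : (Num.truncn (z w i) < L.+1)%N.
  rewrite ltnS; apply: le_truncn.
  rewrite ler_pM2r ?invr_gt0//.
  by have := prho w i; rewrite ler_norml => /andP[]; lra.
pose f w : {ffun 'I_N -> 'I_L.+1} := [ffun i => Ordinal (zL w i)].
have finj : injective f.
  move=> w w' ff; have [//|ww'] := eqVneq w w'.
  have [i] := psep _ _ ww'.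
  have /(congr1 val)/= : f w i = f w' i by rewrite ff.
  rewrite !ffunE /= leNgt => tt /negP[].
  have /andP[a1 a2] := truncn_itv (z0 w i).
  have /andP[b1 b2] := truncn_itv (z0 w' i).
  have : `|z w i - z w' i| < 1.
    rewrite ltr_norml; move: a1 a2 b1 b2; rewrite tt -natr1; lra.
  rewrite /z -mulrBl normrM (gtr0_norm (_ : 0 < h^-1)) ?invr_gt0//.
  by rewrite ltr_pdivrMr// mul1r opprD addrACA subrr addr0.
apply: (@le_trans _ _ ((L.+1 ^ N)%:R)).
  rewrite ler_nat -[X in (X ^ _)%N]card_ord -[X in (_ ^ X)%N]card_ord -card_ffun.
  exact: leq_card finj.
rewrite natrX lerXn2r ?nnegrE//.
- by rewrite addr_ge0// divr_ge0 ?(ltW h0)// mulr_ge0.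
- by rewrite -natr1 lerD2r truncn_le// divr_ge0 ?(ltW h0)// mulr_ge0.
Qed.

(** * Seminorms on real row vectors *)

Section Seminorm.
Variables (R : realType) (N : nat) (nu : 'rV[R]_N -> R).
Hypothesis nuD : forall v w, nu (v + w) <= nu v + nu w.
Hypothesis nuZ : forall a v, nu (a *: v) = `|a| * nu v.

Let nu0 : nu 0 = 0.
Proof. by rewrite -(scale0r (0 : 'rV[R]_N)) nuZ normr0 mul0r. Qed.

Let nuN v : nu (- v) = nu v.
Proof. by rewrite -scaleN1r nuZ normrN1 mul1r. Qed.

Lemma seminorm_ge0 v : 0 <= nu v.
Proof. by have := nuD v (- v); rewrite subrr nu0 nuN; lra. Qed.

Lemma seminorm_le_coord :
  exists2 C : R, 0 < C &
    forall (v : 'rV[R]_N) (h : R), 0 <= h -> (forall i, `|v ord0 i| <= h) ->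
      nu v <= C * h.
Proof.
(* The summand [1] keeps the constant positive, so that it can serve as a divisor. *)
exists (1 + \sum_i nu (delta_mx ord0 i)).
  by rewrite ltr_pwDl// sumr_ge0// => i _; exact: seminorm_ge0.
move=> v h h0 vh.
have : nu v <= \sum_i nu (v ord0 i *: delta_mx ord0 i).
  rewrite [in X in X <= _](row_sum_delta v).
  elim/big_ind2 : _ => //; first by rewrite nu0.
  by move=> x a y b xa yb; apply: le_trans (nuD _ _) (lerD xa yb).
move=> /le_trans; apply.
rewrite mulrDl mul1r ler_wpDl// mulr_suml ler_sum// => i _.
by rewrite nuZ mulrC ler_wpM2l// seminorm_ge0.
Qed.

(** A norm is continuous, hence has a positive minimum on the compact unit sphere; homogeneity
    extends the bound to all vectors. *)
Lemma seminorm_coercive : (forall v, nu v = 0 -> v = 0) ->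
  exists2 c : R, 0 < c & forall v : 'rV[R]_N, `|v| <= c * nu v.
Proof.
move=> nu_eq0; have [C C0 nuC] := seminorm_le_coord.
have nu_le_norm v : nu v <= C * `|v|.
  apply: nuC => // i; rewrite [leRHS]/Num.norm /= mx_normrE.
  exact: (le_bigmax _ (fun ij : 'I_1 * 'I_N => `|v ij.1 ij.2|) (ord0, i)).
have nu_cont : continuous nu.
  move=> v U /nbhs_normP[e /= e0 eU].
  suff : nbhs v (nu @^-1` U) by [].
  apply/(@nbhs_normP R 'rV[R]_N); exists (e / C) => /=.
    exact: divr_gt0.
  move=> w /= vw; apply: eU => /=.
  have vw_e : nu (v - w) < e.
    by apply: le_lt_trans (nu_le_norm _) _; rewrite mulrC -ltr_pdivlMr.
  have := nuD (v - w) w; have := nuD (w - v) v.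
  rewrite !subrK -(opprB v w) nuN ltr_norml; lra.
pose A := [set v : 'rV[R]_N | `|v| = 1].
have A_compact : compact A.
  apply: bounded_closed_compact.
    by exists 1; split=> // M M1 v /= ->; exact: ltW.
  have -> : A = (fun v : 'rV[R]_N => `|v|) @^-1` [set 1] by [].
  by apply: closed_comp => [v _|]; [exact: norm_continuous|exact: closed_eq].
have unitA v : v != 0 -> A (`|v|^-1 *: v).
  move=> v0; rewrite /A /= normrZ normfV normr_id mulVf// normr_eq0 //.
(* An empty sphere means that [0] is the only vector, and any constant works. *)
have [A0|/set0P A_neq0] := eqVneq A set0.
  exists 1 => // v; rewrite mul1r; have [->|/unitA] := eqVneq v 0.
    by rewrite normr0 nu0.
  by rewrite A0.
have [w wA wmin] : exists2 w, w \in A & forall t, t \in A -> nu w <= nu t.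
  apply: EVT_min_rV => //; exact: continuous_subspaceT.
have nuw0 : 0 < nu w.
  rewrite lt_neqAle seminorm_ge0 andbT eq_sym; apply/eqP => /nu_eq0 w0.
  by move: wA; rewrite inE w0 /A /= normr0 => /esym/eqP; rewrite oner_eq0.
exists (nu w)^-1; first by rewrite invr_gt0.
move=> v; have [->|v0] := eqVneq v 0; first by rewrite normr0 nu0 mulr0.
have := wmin _ (mem_set (unitA _ v0)).
rewrite nuZ normfV normr_id => wv.
rewrite mulrC ler_pdivlMr// mulrC -ler_pdivlMr ?normr_gt0//.
by rewrite mulrC.
Qed.

(** * Sharp packing bound by base-[q] expansions *)

Section Packing.
Variables (m : nat) (x : 'I_m -> 'rV[R]_N) (D eps : R).
Hypotheses (D0 : 0 < D) (eps0 : 0 < eps).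
Hypothesis x_diam : forall i j, nu (x i - x j) <= D.
Hypothesis x_sep : forall i j, i != j -> eps <= nu (x i - x j).

(** With this ratio [D / (1 - q) = D + eps] and [q * (D + eps) = eps]: the tails after a differing
    digit can just not cancel the separation [eps] of that digit. Its inverse is the constant
    [1 + D / eps] to be proved. *)
Let q := eps / (D + eps).

Let De0 : 0 < D + eps. Proof. by rewrite addr_gt0. Qed.

Let q_gt0 : 0 < q. Proof. by rewrite divr_gt0. Qed.

Let q_lt1 : q < 1. Proof. by rewrite ltr_pdivrMr// mul1r ltrDr. Qed.

Let qDe : q * (D + eps) = eps. Proof. by rewrite divfK// gt_eqF. Qed.

Let digits (s : seq 'I_m) : 'rV[R]_N := foldr (fun i v => x i + q *: v) 0 s.

Let digits_consB i j s t :
  digits (i :: s) - digits (j :: t) = (x i - x j) + q *: (digits s - digits t).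
Proof. by rewrite /= scalerBr opprD addrACA. Qed.

(** The right side is the geometric sum of [D * q ^+ i] over [i < size s]. The deficit [q ^+ size s]
    against the full series is what remains as separation in [digits_sep]. *)
Let digits_diam s t : size s = size t ->
  nu (digits s - digits t) <= (D + eps) * (1 - q ^+ size s).
Proof.
elim: s t => [|i s IHs] [|j t]//.
  by rewrite subrr nu0 expr0 subrr mulr0.
move=> -[st]; rewrite digits_consB; apply: le_trans (nuD _ _) _.
rewrite nuZ gtr0_norm//= exprS.
have := ler_wpM2l (ltW q_gt0) (IHs _ st); have := x_diam i j.
rewrite mulrA qDe [X in _ -> _ -> _ <= X]mulrBr mulrA [_ * q]mulrC qDe; lra.
Qed.

(** Equal leading digits only rescale by [q]. At the first differing digit the separation is at
    least [eps], and the scaled tails take away at most [eps * (1 - q ^+ l)], with [l] the length of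
    the tails. *)
Let digits_sep s t : size s = size t -> s != t ->
  eps * q ^+ size s <= nu (digits s - digits t).
Proof.
elim: s t => [|i s IHs] [|j t]// -[st].
rewrite eqseq_cons negb_and digits_consB /= exprS.
have [<-/= {j}st_neq|ij _] := eqVneq i j.
  rewrite subrr add0r nuZ gtr0_norm// mulrCA ler_wpM2l ?(ltW q_gt0)//.
  exact: IHs.
have le1 : eps <= nu (x i - x j + q *: (digits s - digits t))
           + q * nu (digits s - digits t).
  apply: le_trans (x_sep ij) _.
  rewrite -[X in X * nu _](gtr0_norm q_gt0) -nuZ -(nuN (q *: _)).
  by apply: le_trans (nuD _ _); rewrite addrK.
have := ler_wpM2l (ltW q_gt0) (digits_diam st).
rewrite [X in _ <= X -> _]mulrA qDe.
have : eps * (q * q ^+ size s) <= eps * q ^+ size s.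
  by rewrite ler_pM2l// ler_piMl ?exprn_ge0 ?ltW.
lra.
Qed.

(* The words of length [j] in the alphabet of the [m] points, read as base-[q]
   expansions, form [m ^ j] points of a fixed bounded set that are
   [eps * q ^ j]-separated; a crude grid count of these and [j --> oo] give
   the sharp constant. *)
Lemma packing : m%:R <= (1 + D / eps) ^+ N.
Proof.
have [C C0 nuC] := seminorm_le_coord.
pose rho0 := \sum_i \sum_l `|x i ord0 l|.
have xrho i l : `|x i ord0 l| <= rho0.
  rewrite /rho0 (bigD1 i)//= (bigD1 l)//= -addrA ler_wpDr//.
  by rewrite addr_ge0// !sumr_ge0// => *; rewrite sumr_ge0.
have rho00 : 0 <= rho0 by rewrite !sumr_ge0// => *; rewrite sumr_ge0.
(* The fixed point of [r -> rho0 + q * r], hence a coordinate bound for expansions of every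
   length. *)
pose rho := rho0 / (1 - q).
have rhoq : rho0 + q * rho = rho.
  by rewrite /rho; field; rewrite gt_eqF// subr_gt0.
have rhoge0 : 0 <= rho by rewrite divr_ge0// subr_ge0 ltW.
have digits_rho s l : `|digits s ord0 l| <= rho.
  elim: s => [|i s IHs]; first by rewrite /= mxE normr0.
  rewrite /= !mxE -rhoq (le_trans (ler_normD _ _))// lerD//.
  by rewrite normrM gtr0_norm// ler_pM2l.
pose C' := 4 * rho * C / eps + 1.
have C0' : 0 <= C'.
  apply: addr_ge0; last by [].
  by apply: divr_ge0 (ltW eps0); apply: mulr_ge0 (ltW C0); apply: mulr_ge0.
have count (j : nat) : (m%:R * q ^+ N) ^+ j <= C' ^+ N.
  (* Points closer than [h] in every coordinate are within [C * h = eps * q ^+ j / 2] for [nu],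
     below the separation of the words of length [j]. *)
  pose h := eps * q ^+ j / (2 * C).
  have qj0 : 0 < q ^+ j by rewrite exprn_gt0.
  have h0 : 0 < h by rewrite divr_gt0 ?mulr_gt0.
  have := @card_grid_separated R N (j.-tuple 'I_m) (fun s => digits s) rho h
    rhoge0 h0.
  have -> : (#|{: j.-tuple 'I_m}|%:R : R) = m%:R ^+ j.
    by rewrite card_tuple card_ord natrX.
  move=> count; rewrite exprMn -exprM mulnC exprM -ler_pdivlMr ?exprn_gt0//.
  apply: le_trans (count _ _) _ => [s i|s t st|].
  - exact: digits_rho.
  - apply: contrapT => /forallNP near_st.
    have : nu (digits s - digits t) <= C * h.
      apply: nuC => [|i]; first exact: ltW.
      by have /negP := near_st i; rewrite -ltNge !mxE => /ltW.
    apply/negP; rewrite -ltNge; apply: (@lt_le_trans _ _ (eps * q ^+ j)).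
      rewrite /h (_ : _ * _ = eps * q ^+ j / 2); last by field; rewrite gt_eqF.
      by have := mulr_gt0 eps0 qj0; lra.
    by rewrite -[X in q ^+ X](size_tuple s) digits_sep// !size_tuple.
  - rewrite -expr_div_n lerXn2r ?nnegrE//.
    + by apply: addr_ge0 => //; apply: divr_ge0 (ltW h0); apply: mulr_ge0.
    + by apply: divr_ge0 => //; exact: ltW.
    rewrite /C' /h ler_pdivlMr//.
    have -> : (2 * rho / (eps * q ^+ j / (2 * C)) + 1) * q ^+ j
              = 4 * rho * C / eps + q ^+ j.
      by field; rewrite !gt_eqF.
    by rewrite lerD2l exprn_ile1 ?ltW.
have := bounded_exprn_le1 count.
rewrite -ler_pdivlMr ?exprn_gt0// => /le_trans; apply.
rewrite mul1r -exprVn.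
suff -> : q^-1 = 1 + D / eps by [].
by rewrite /q; field; rewrite !gt_eqF.
Qed.

End Packing.
End Seminorm.

(** * Real coordinates and the Banach-Mazur distance *)

(** An [R]-linear isomorphism onto [E]. Real scalars act on [E] through [of_real], which treats real
    and complex spaces uniformly. *)
Definition real_coordinates (R : realType) (k : scalar_kind) (N : nat)
    (E : lmodType (scalar_field R k)) (phi : 'rV[R]_N -> E) : Prop :=
  [/\ forall v w, phi (v + w) = phi v + phi w,
      forall a v, phi (a *: v) = of_real k a *: phi v,
      forall v, phi v = 0 -> v = 0 &
      forall x, exists v, phi v = x].

Section CoordinatesRV.
Import complex.

(** Over the complex numbers the first [n] real coordinates are the real parts and the last [n] the
    imaginary parts; this is the source of the factor 2 in the dimension bound. *)
Lemma real_coordinates_rV (R : realType) (k : scalar_kind) (n : nat) :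
  exists phi : 'rV[R]_(real_multiplicity k n) -> 'rV[scalar_field R k]_n,
    real_coordinates phi.
Proof.
case: k; first by exists id; split=> // x; exists x.
pose re (i : 'I_n) := cast_ord (addnn n) (lshift n i).
pose im (i : 'I_n) := cast_ord (addnn n) (rshift n i).
exists (fun v => \row_i Complex (v ord0 (re i)) (v ord0 (im i))); split.
- by move=> v w; apply/rowP => i; rewrite !mxE.
- move=> a v; apply/rowP => i; rewrite !mxE /= /real_complex_def.
  by apply/eqP; rewrite eq_complex /= !mul0r subr0 addr0 !eqxx.
- move=> v v0; apply/rowP => j; rewrite mxE.
  rewrite -(cast_ordKV (addnn n) j).
  case: (splitP (cast_ord (esym (addnn n)) j)) => i ji.
  + have -> : cast_ord (esym (addnn n)) j = lshift n i by apply: val_inj.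
    by have /rowP/(_ i) := v0; rewrite !mxE => -[].
  + have -> : cast_ord (esym (addnn n)) j = rshift n i by apply: val_inj.
    by have /rowP/(_ i) := v0; rewrite !mxE => -[].
- move=> u; exists (\row_j match fintype.split (cast_ord (esym (addnn n)) j) with
                           | inl i => complex.Re (u ord0 i)
                           | inr i => complex.Im (u ord0 i) end).
  apply/rowP => i; rewrite !mxE !cast_ordK.
  rewrite -[lshift n i]/(unsplit (inl i)) -[rshift n i]/(unsplit (inr i)).
  by rewrite !unsplitK; case: (u ord0 i).
Qed.

End CoordinatesRV.

Lemma real_coordinates_comp (R : realType) (k : scalar_kind) (N : nat)
    (E F : lmodType (scalar_field R k)) (phi : 'rV[R]_N -> E)
    (L : {linear E -> F}) (Li : F -> E) :
  cancel L Li -> cancel Li L ->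
  real_coordinates phi -> real_coordinates (L \o phi).
Proof.
move=> LK LiK [phiD phiZ phi_eq0 phi_surj]; split=> /=.
- by move=> v w; rewrite phiD linearD.
- by move=> a v; rewrite phiZ linearZ.
- move=> v Lv0; apply: phi_eq0; rewrite -(LK (phi v)) Lv0.
  by rewrite -(linear0 L) LK.
- by move=> y; have [v vy] := phi_surj (Li y); exists v; rewrite vy LiK.
Qed.

Lemma has_dim_linear_iso (R : realType) (k : scalar_kind) (n : nat)
    (E : lmodType (scalar_field R k)) : has_dim n E ->
  exists (L : {linear E -> 'rV[scalar_field R k]_n})
         (Li : {linear 'rV[scalar_field R k]_n -> E}),
    cancel L Li /\ cancel Li L.
Proof.
move=> [[f f_lin [g fK gK]]].
pose L : {linear E -> 'rV[scalar_field R k]_n} :=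
  HB.pack f (GRing.isLinear.Build _ _ _ _ f f_lin).
have g_lin : linear g.
  move=> a u v; apply: (can_inj fK); rewrite gK.
  by have := f_lin a (g u) (g v); rewrite !gK.
pose Li : {linear 'rV[scalar_field R k]_n -> E} :=
  HB.pack g (GRing.isLinear.Build _ _ _ _ g g_lin).
by exists L, Li.
Qed.

Section NormedSpace.
Variables (R : realType) (k : scalar_kind) (E : normedModType (scalar_field R k)).

Lemma rnorm_coordD (N : nat) (phi : 'rV[R]_N -> E) : real_coordinates phi ->
  forall v w, rnorm (phi (v + w)) <= rnorm (phi v) + rnorm (phi w).
Proof. by move=> [phiD _ _ _] v w; rewrite phiD ler_rnormD. Qed.

Lemma rnorm_coordZ (N : nat) (phi : 'rV[R]_N -> E) : real_coordinates phi ->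
  forall a v, rnorm (phi (a *: v)) = `|a| * rnorm (phi v).
Proof. by move=> [_ phiZ _ _] a v; rewrite phiZ rnormZ rnorm_of_real. Qed.

Lemma packing_rnorm (n m : nat) (x : 'I_m -> E) (D eps : R) :
  has_dim n E -> 0 < D -> 0 < eps ->
  (forall i j, rnorm (x i - x j) <= D) ->
  (forall i j, i != j -> eps <= rnorm (x i - x j)) ->
  m%:R <= (1 + D / eps) ^+ real_multiplicity k n.
Proof.
move=> /has_dim_linear_iso[L [Li [LK LiK]]] D0 eps0 x_diam x_sep.
have [phi0 phi0P] := real_coordinates_rV R k n.
have phiP := real_coordinates_comp LiK LK phi0P.
set phi := Li \o phi0 in phiP.
have [phiD phiZ _ phi_surj] := phiP.
have /choice[v vx] : forall i, exists v, phi v = x i by move=> i.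
have phiB i j : phi (v i - v j) = x i - x j.
  rewrite phiD -scaleN1r phiZ !vx; congr (_ + _).
  by rewrite of_realN of_real1 scaleN1r.
apply: (@packing R _ (fun v => rnorm (phi v)) _ _ m v) => //.
- exact: rnorm_coordD.
- exact: rnorm_coordZ.
- by move=> i j; rewrite phiB.
- by move=> i j; rewrite phiB; exact: x_sep.
Qed.

(** A real [sup] dominates the members of its set only when they are bounded above; this lemma and
    the next provide that for the two operator norms in [dBM]. *)
Lemma linear_from_rV_bounded (n : nat)
    (L : {linear 'rV[scalar_field R k]_n -> E}) :
  has_ubound [set rnorm (L u) | u in [set u | l2norm u <= 1]].
Proof.
exists (\sum_i rnorm (L (delta_mx ord0 i))) => _ [u /= u1 <-].
rewrite {1}(row_sum_delta u) linear_sum.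
apply: (@le_trans _ _ (\sum_i rnorm (L (u ord0 i *: delta_mx ord0 i)))).
  elim/big_ind2 : _ => //; first by rewrite rnorm0.
  by move=> x a y b xa yb; apply: le_trans (ler_rnormD _ _) (lerD xa yb).
apply: ler_sum => i _; rewrite linearZ rnormZ ler_piMl ?rnorm_ge0//.
suff : rnorm (u ord0 i) ^+ 2 <= 1 by rewrite expr_le1// rnorm_ge0.
apply: (@le_trans _ _ (l2norm u ^+ 2)); last first.
  by rewrite expr_le1// sqrtr_ge0.
rewrite sqr_sqrtr; last by apply: sumr_ge0 => j _; exact: sqr_ge0.
by rewrite (bigD1 i)//= lerDl sumr_ge0// => j _; exact: sqr_ge0.
Qed.

(** In real coordinates each entry of [L x] is a seminorm, bounded by the sup norm of the coordinate
    vector, which coercivity bounds by [rnorm x]. *)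
Lemma linear_to_rV_bounded (n : nat)
    (L : {linear E -> 'rV[scalar_field R k]_n}) (Li : {linear 'rV_n -> E}) :
  cancel L Li -> cancel Li L ->
  has_ubound [set l2norm (L x) | x in [set x | rnorm x <= 1]].
Proof.
move=> LK LiK; have [phi0 phi0P] := real_coordinates_rV R k n.
have phiP := real_coordinates_comp LiK LK phi0P.
have [phiD phiZ phi_eq0 phi_surj] := phiP.
have [c c0 phi_coercive] := seminorm_coercive (rnorm_coordD phiP)
  (rnorm_coordZ phiP) (fun v v0 => phi_eq0 v (rnorm_eq0 v0)).
have coord_bounded i : exists C : R, forall v : 'rV[R]__,
    rnorm (phi0 v ord0 i) <= C * `|v|.
  have [phi0D phi0Z _ _] := phi0P.
  have [||C C0 vC] := @seminorm_le_coord R _ (fun v => rnorm (phi0 v ord0 i)).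
  - by move=> v w; rewrite phi0D mxE ler_rnormD.
  - by move=> a v; rewrite phi0Z mxE rnormM rnorm_of_real.
  - exists C => v; apply: vC => // j; rewrite [leRHS]/Num.norm /= mx_normrE.
    exact: (le_bigmax _ (fun ij => `|v ij.1 ij.2|) (ord0, j)).
have /choice[C coordC] := coord_bounded.
exists (Num.sqrt (\sum_i (`|C i| * c) ^+ 2)) => _ [x /= x1 <-].
have [v vx] := phi_surj x; move: x1; rewrite -vx /= LiK => x1.
rewrite ler_wsqrtr// ler_sum// => i _; rewrite lerXn2r ?nnegrE ?rnorm_ge0//.
  by rewrite mulr_ge0// ltW.
apply: le_trans (coordC i v) _; apply: le_trans (ler_norm _) _.
rewrite normrM normr_id ler_wpM2l//; apply: le_trans (phi_coercive v) _.
by rewrite ler_piMr// ltW.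
Qed.

Lemma l2normZ_delta (n : nat) (i : 'I_n) (c : R) : 0 <= c ->
  l2norm (of_real k c *: (delta_mx ord0 i : 'rV[scalar_field R k]_n)) = c.
Proof.
move=> c0; rewrite /l2norm (bigD1 i)//= big1 => [|j ji]; last first.
  by rewrite !mxE (negbTE ji) andbF mulr0 rnorm0 expr0n.
by rewrite !mxE !eqxx mulr1 rnorm_of_real addr0 sqrtr_sqr normr_id ger0_norm.
Qed.

(** Testing [Li] on a unit basis vector [e], and [L] on [Li e] divided by its norm [r], shows that
    the two operator norms are at least [r] and [r^-1]. *)
Lemma dBM_ge1 (n : nat) : (0 < n)%N -> has_dim n E -> 1 <= dBM n E.
Proof.
move=> n0 /has_dim_linear_iso[L0 [Li0 [L0K Li0K]]].
apply: lb_le_inf; first by eexists; exists L0, Li0; split.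
move=> _ [L [Li [LK LiK ->]]].
pose e : 'rV[scalar_field R k]_n := delta_mx ord0 (Ordinal n0).
have e_unit : l2norm e = 1.
  by rewrite -[e]scale1r -(of_real1 R k) l2normZ_delta.
pose r := rnorm (Li e).
have r_le : r <= opnorm (@l2norm R k n) (@rnorm R k E) Li.
  apply: ub_le_sup; first exact: linear_from_rV_bounded.
  by exists e => //=; rewrite e_unit.
have r0 : 0 < r.
  rewrite lt_neqAle rnorm_ge0 andbT eq_sym; apply/eqP => /rnorm_eq0 Lie0.
  have := l2normZ_delta (Ordinal n0) (ler01 : 0 <= (1 : R)).
  rewrite of_real1 scale1r -/e -(LiK e) Lie0 linear0 => /eqP.
  have := l2normZ_delta (Ordinal n0) (lexx (0 : R)).
  by rewrite of_real0 scale0r => ->; rewrite eq_sym oner_eq0.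
have rV_le : r^-1 <= opnorm (@rnorm R k E) (@l2norm R k n) L.
  apply: ub_le_sup; first exact: linear_to_rV_bounded LK LiK.
  exists (of_real k r^-1 *: Li e) => /=.
    by rewrite rnormZ rnorm_of_real gtr0_norm ?invr_gt0// mulVf// gt_eqF.
  by rewrite linearZ LiK l2normZ_delta// invr_ge0 ltW.
apply: (@le_trans _ _ (r^-1 * r)); first by rewrite mulVf// gt_eqF.
apply: ler_pM => //; last exact: ltW.
by rewrite invr_ge0 ltW.
Qed.

End NormedSpace.

(** * Covers produced by the squeezing property *)

(** Packing bounds the size of [eps]-separated families, so a largest one exists; it is a net, since
    a point far from all its members could be added. *)
Lemma finite_net (R : realType) (k : scalar_kind)
    (E : normedModType (scalar_field R k)) (n : nat) (T : Type) (f : T -> E)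
    (A : set T) (D eps : R) :
  has_dim n E -> 0 < D -> 0 < eps ->
  (forall x y, A x -> A y -> rnorm (f x - f y) <= D) ->
  exists m (x : 'I_m -> T),
    [/\ m%:R <= (1 + D / eps) ^+ real_multiplicity k n, forall i, A (x i) &
        forall y, A y -> exists i, rnorm (f y - f (x i)) < eps].
Proof.
move=> dimE D0 eps0 A_diam.
pose separated m := exists x : 'I_m -> T, (forall i, A (x i)) /\
  forall i j, i != j -> eps <= rnorm (f (x i) - f (x j)).
have separated_le m : separated m ->
    m%:R <= (1 + D / eps) ^+ real_multiplicity k n.
  move=> [x [Ax x_sep]]; apply: (packing_rnorm dimE D0 eps0 (x := f \o x)) => //.
  by move=> i j; exact: A_diam.
have ex_sep : exists m, `[< separated m >].
  have x0 : 'I_0 -> T by case.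
  by exists 0%N; apply/asboolP; exists x0; split; case.
have sep_ub m : `[< separated m >] ->
    (m <= Num.truncn ((1 + D / eps) ^+ real_multiplicity k n : R))%N.
  by move=> /asboolP/separated_le/le_truncn; rewrite natrK.
have [m /asboolP m_sep m_max] := ex_maxnP ex_sep sep_ub.
have [x [Ax x_sep]] := m_sep.
exists m, x; split=> //; first exact: separated_le.
move=> y Ay; apply: contrapT => /forallNP far.
suff /asboolP/m_max : separated m.+1 by rewrite ltnn.
exists (fun j => if unlift ord0 j is Some i then x i else y); split.
  by move=> j; case: unliftP.
have far' i : eps <= rnorm (f y - f (x i)).
  by rewrite leNgt; apply/negP; exact: far.
move=> i j; case: unliftP => [i'|] ->; case: unliftP => [j'|] ->.
- by rewrite (inj_eq lift_inj); exact: x_sep.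
- by rewrite rdistC.
- by [].
- by rewrite eqxx.
Qed.

Definition diam_le (R : realType) (k : scalar_kind)
    (X : normedZmodType (scalar_field R k)) (A : set X) (d : R) : Prop :=
  forall x y, A x -> A y -> rnorm (x - y) <= d.

(** The pieces must lie inside [A], so that squeezing applies to them again and points picked from
    them stay in [A]. *)
Definition finite_cover (R : realType) (k : scalar_kind)
    (X : normedZmodType (scalar_field R k)) (A : set X) (d : R)
    (s : seq (set X)) : Prop :=
  (forall C, C \in s -> C `<=` A /\ diam_le C d) /\
  (forall x, A x -> exists2 C, C \in s & C x).

Section Squeezing.
Variables (R : realType) (k : scalar_kind) (X Xn : normedModType (scalar_field R k)).

Lemma squeezing_cover (S : R -> X -> X) (B : set X) (T : R) (n : nat)
    (eta mu kappa sigma d : R) (P : X -> Xn) (A : set X) :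
  generalized_squeezing S B T n eta mu kappa P -> 0 < sigma ->
  A `<=` B -> 0 < d -> diam_le A d ->
  exists2 s,
    (size s)%:R <= (1 + 2 * kappa * mu / sigma) ^+ real_multiplicity k n &
    finite_cover (S T @` A) ((eta + sigma) * d) s.
Proof.
move=> [[n0 dimXn] /andP[eta0 eta1] mu0 kappa0 squeeze] sigma0 AB d0 A_diam.
(* Two points of one cell have [P]-values within [2 * eps], and [mu * (2 * eps) = sigma * d] is the
   allowed increase over [eta * d]. *)
pose eps := sigma * d / (2 * mu).
have eps0 : 0 < eps by rewrite divr_gt0 ?mulr_gt0.
have [||m [x [m_le Ax x_net]]] := @finite_net R k Xn n X (fun y => P (S T y)) A
    (kappa * d) eps dimXn _ eps0; first exact: mulr_gt0.
  move=> y z Ay Az; have [_] := squeeze y z (AB _ Ay) (AB _ Az).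
  by move=> /le_trans; apply; rewrite ler_pM2l//; exact: A_diam.
pose C i := [set S T y | y in
  A `&` [set y | rnorm (P (S T y) - P (S T (x i))) < eps]].
exists [seq C i | i <- enum 'I_m].
  rewrite size_map size_enum_ord; apply: le_trans m_le _.
  rewrite (_ : kappa * d / eps = 2 * kappa * mu / sigma)// /eps.
  by field; rewrite !gt_eqF.
split.
  move=> _ /mapP[i _ ->]; split; first by move=> _ [y [Ay _] <-]; exists y.
  move=> _ _ [y [Ay /= yi] <-] [z [Az /= zi] <-].
  have [yz _] := squeeze y z (AB _ Ay) (AB _ Az).
  have := ler_rdistD (P (S T (x i))) (P (S T y)) (P (S T z)).
  rewrite (rdistC (P (S T (x i))) (P (S T z))) => yz'.
  have {yz'} : mu * rnorm (P (S T y) - P (S T z)) <= mu * (2 * eps).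
    by rewrite ler_pM2l//; lra.
  have -> : mu * (2 * eps) = sigma * d by rewrite /eps; field; rewrite gt_eqF.
  have := ler_wpM2l eta0 (A_diam _ _ Ay Az).
  by rewrite mulrDl; lra.
move=> _ [y Ay <-]; have [i yi] := x_net y Ay.
by exists (C i); [rewrite map_f// mem_enum|exists y].
Qed.

Lemma iterated_cover (f : X -> X) (B : set X) (theta d Q : R) :
  0 < theta -> 0 < d -> 0 <= Q -> f @` B `<=` B -> diam_le B d ->
  (forall (A : set X) d', A `<=` B -> 0 < d' -> diam_le A d' ->
    exists2 s, (size s)%:R <= Q & finite_cover (f @` A) (theta * d') s) ->
  forall j, exists2 s, (size s)%:R <= Q ^+ j &
    finite_cover (iter j f @` B) (theta ^+ j * d) s.
Proof.
move=> theta0 d0 Q0 fB B_diam step; elim=> [|j [s s_le [sP s_cov]]].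
  exists [:: B]; rewrite ?expr0// mul1r.
  split=> [C|_ [x Bx <-]]; last by exists B; rewrite ?inE.
  by rewrite inE => /eqP ->; split=> // x Bx; exists x.
have iterB i x : B x -> B (iter i f x).
  by move=> Bx; elim: i => //= i IHi; apply: fB; exists (iter i f x).
have : forall C, exists t, C \in s ->
    (size t)%:R <= Q /\ finite_cover (f @` C) (theta ^+ j.+1 * d) t.
  move=> C; have [Cs|] := boolP (C \in s); last by exists [::].
  have [CD C_diam] := sP _ Cs.
  have [||t t_le tP] := step C (theta ^+ j * d) _ _ C_diam.
  - by move=> x /CD[y By <-]; exact: iterB.
  - by rewrite mulr_gt0// exprn_gt0.
  - by exists t => _; split=> //; rewrite exprS -mulrA.
move=> /choice[t tP].
exists (flatten [seq t C | C <- s]).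
  apply: (@le_trans _ _ ((size s)%:R * Q)); last first.
    by rewrite exprSr ler_wpM2r.
  have {s_le sP s_cov} : forall C, C \in s -> (size (t C))%:R <= Q.
    by move=> C /tP[].
  elim: s {tP} => [|C s IHs] tQ; first by rewrite mul0r.
  rewrite /= size_cat natrD -natr1 mulrDl mul1r addrC lerD//.
    by apply: IHs => C' C's; apply: tQ; rewrite inE C's orbT.
  by apply: tQ; rewrite inE eqxx.
split.
  move=> C /flattenP[_ /mapP[C' C's ->] CC'].
  have [_ [/(_ _ CC')[CfC' C_diam] _]] := tP _ C's.
  split=> // x /CfC'[y C'y <-].
  by have [/(_ _ C'y)[z Bz <-] _] := sP _ C's; exists z.
move=> _ [x Bx <-] /=.
have [|C' C's C'x] := s_cov (iter j f x); first by exists x.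
have [_ [_ t_cov]] := tP _ C's.
have [|C Ct Cx] := t_cov (f (iter j f x)); first by exists (iter j f x).
by exists C => //; apply/flattenP; exists (t C') => //; exact: map_f.
Qed.

Lemma iterated_net (f : X -> X) (B : set X) (theta d Q : R) :
  0 < theta -> 0 < d -> 0 <= Q -> f @` B `<=` B -> diam_le B d ->
  (forall (A : set X) d', A `<=` B -> 0 < d' -> diam_le A d' ->
    exists2 s, (size s)%:R <= Q & finite_cover (f @` A) (theta * d') s) ->
  exists W : nat -> seq X, forall j,
    [/\ (size (W j))%:R <= Q ^+ j, forall w, w \in W j -> (iter j f @` B) w &
        forall x, (iter j f @` B) x ->
          exists2 w, w \in W j & rnorm (x - w) <= theta ^+ j * d].
Proof.
move=> theta0 d0 Q0 fB B_diam step.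
suff /choice[W WP] : forall j, exists s : seq X,
    [/\ (size s)%:R <= Q ^+ j, forall w, w \in s -> (iter j f @` B) w &
        forall x, (iter j f @` B) x ->
          exists2 w, w \in s & rnorm (x - w) <= theta ^+ j * d] by exists W.
move=> j.
have [s s_le [sP s_cov]] := iterated_cover theta0 d0 Q0 fB B_diam step j.
(* One point per nonempty piece; on an empty piece [xget] would return the default [0], which may
   lie outside the image. *)
exists [seq xget 0 C | C <- s & `[< C !=set0 >]]; split.
- rewrite size_map; apply: le_trans s_le; rewrite ler_nat size_filter.
  exact: count_size.
- move=> _ /mapP[C +] ->; rewrite mem_filter => /andP[/asboolP[x Cx] /sP[CD _]].
  by apply: CD; case: xgetP => // /(_ x).
- move=> x /s_cov[C Cs Cx]; have [_ C_diam] := sP _ Cs.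
  exists (xget 0 C); last by apply: C_diam => //; case: xgetP => // /(_ x).
  by rewrite map_f// mem_filter Cs andbT; apply/asboolP; exists x.
Qed.

End Squeezing.

(** * The attractor spanned by the nets *)

Lemma near_geometric_lt (R : realType) (theta d e : R) :
  0 < theta < 1 -> 0 < d -> 0 < e -> \forall j \near \oo, theta ^+ j * d < e.
Proof.
move=> /andP[theta0 theta1] d0 e0.
have : (GRing.exp theta : nat -> R) @ \oo --> (0 : R).
  by apply: cvg_expr; rewrite gtr0_norm.
move=> /cvgrPdist_lt/(_ (e / d)) []; first exact: divr_gt0.
move=> j0 _ jP; exists j0 => // j /jP /=.
by rewrite sub0r normrN gtr0_norm ?exprn_gt0// ltr_pdivlMr.
Qed.

(** When [f] maps [B] into itself the iterated images decrease, so each equals the union over later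
    times in the usual definition. *)
Definition omega_limit (R : realType) (k : scalar_kind)
    (X : normedModType (scalar_field R k)) (f : X -> X) (B : set X) : set X :=
  \bigcap_j closure (iter j f @` B).

(** Level [j] gathers the images of [W i] under [j - i] steps of [f], for all [i <= j]. Thus [f]
    maps level [j] into level [j + 1], and level [j] stays in the [j]-th image of [B]. *)
Fixpoint net_orbits (X : Type) (f : X -> X) (W : nat -> seq X) (j : nat) :
    seq X :=
  if j is i.+1 then W i.+1 ++ [seq f x | x <- net_orbits f W i] else W 0%N.

Definition net_attractor (R : realType) (k : scalar_kind)
    (X : normedModType (scalar_field R k)) (f : X -> X) (B : set X)
    (W : nat -> seq X) : set X :=
  omega_limit f B `|` [set x | exists j, x \in net_orbits f W j].

Section NetAttractor.
Variables (R : realType) (k : scalar_kind).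
Variables (X : completeNormedModType (scalar_field R k)) (f : X -> X).
Variables (B : set X) (W : nat -> seq X) (theta d Q : R).
Hypotheses (theta01 : 0 < theta < 1) (d0 : 0 < d) (Q1 : 1 <= Q).
Hypothesis fB : f @` B `<=` B.
Hypothesis netP : forall j,
  [/\ (size (W j))%:R <= Q ^+ j, forall w, w \in W j -> (iter j f @` B) w &
      forall x, (iter j f @` B) x ->
        exists2 w, w \in W j & rnorm (x - w) <= theta ^+ j * d].

Let D j : set X := iter j f @` B.
Let E := net_orbits f W.
Let M := net_attractor f B W.

Lemma iter_image_anti i j : (i <= j)%N -> D j `<=` D i.
Proof.
move=> ij _ [x Bx <-]; exists (iter (j - i) f x); last by rewrite -iterD subnKC.
by elim: (j - i)%N => //= m IHm; apply: fB; exists (iter m f x).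
Qed.

Lemma net_orbits_sub j x : x \in E j -> D j x.
Proof.
elim: j x => [|j IHj] x /=; first by have [_ + _] := netP 0%N; exact.
rewrite mem_cat => /orP[|/mapP[y /IHj[z Bz <-] ->]]; last by exists z.
by have [_ + _] := netP j.+1; exact.
Qed.

Lemma size_net_orbits j : (size (E j))%:R <= j.+1%:R * Q ^+ j.
Proof.
elim: j => [|j IHj] /=; first by have [+ _ _] := netP 0%N; rewrite mul1r.
have [Wj _ _] := netP j.+1.
rewrite size_cat size_map natrD -[in leRHS]natr1 mulrDl mul1r addrC lerD//.
apply: le_trans IHj _; rewrite ler_wpM2l// exprS ler_peMl//.
by rewrite exprn_ge0// (le_trans ler01).
Qed.

Lemma net_in_orbits j w : w \in W j -> w \in E j.
Proof. by case: j => //= j; rewrite mem_cat => ->. Qed.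

Lemma orbits_sub_attractor j x : x \in E j -> M x.
Proof. by move=> xE; right; exists j. Qed.

(** All of [M] except the finitely many points of levels below [j] lies in the closure of [D j];
    covering and closedness both rest on this. *)
Lemma attractor_sub_closure j x : M x ->
  closure (D j) x \/ exists2 i, (i < j)%N & x \in E i.
Proof.
move=> [x_omega|[i xE]]; first by left; exact: x_omega.
have [ij|ji] := ltnP i j; first by right; exists i.
by left; apply: subset_closure; exact: (iter_image_anti ji (net_orbits_sub xE)).
Qed.

(** The centers are all points of levels [0] to [j]: the lower levels cover themselves, and [W j]
    covers the closure of [D j]. There are [j + 1] levels of at most [(j + 1) * Q ^+ j] points. *)
Lemma attractor_cover j e : theta ^+ j * d < e ->
  exists s : seq X, [/\ (size s)%:R <= j.+1%:R ^+ 2 * Q ^+ j,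
    forall c, c \in s -> M c &
    forall x, M x -> exists2 c, c \in s & rnorm (c - x) < e].
Proof.
move=> je; have e0 : 0 < e.
  case/andP: theta01 => theta0 _.
  by apply: lt_trans je; rewrite mulr_gt0// exprn_gt0.
exists (flatten [seq E i | i <- iota 0 j.+1]); split.
- have : forall i, i \in iota 0 j.+1 -> (size (E i))%:R <= j.+1%:R * Q ^+ j.
    move=> i; rewrite mem_iota add0n ltnS => /= ij.
    apply: le_trans (size_net_orbits i) _.
    have Q0 : 0 <= Q by exact: le_trans ler01 Q1.
    apply: ler_pM; rewrite ?ler_nat ?exprn_ge0//.
    by apply: (ler_weXn2l Q1).
  rewrite -[X in X%:R ^+ 2](size_iota 0 j.+1) expr2 -mulrA size_iota.
  rewrite -[X in X%:R * (_ * _)](size_iota 0 j.+1).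
  elim: (iota 0 j.+1) => [|i l IHl] El /=; first by rewrite mul0r.
  rewrite size_cat natrD -natr1 mulrDl mul1r addrC lerD//.
    by apply: IHl => i' i'l; apply: El; rewrite inE i'l orbT.
  by apply: El; rewrite inE eqxx.
- by move=> c /flattenP[_ /mapP[i _ ->]]; exact: orbits_sub_attractor.
- move=> x /(attractor_sub_closure j)[/closure_rnormP|[i ij xE]].
    (* The strict gap between the mesh and [e] pays for passing from the closure to [D j]. *)
    move=> /(_ (e - theta ^+ j * d)) [|y Dy xy]; first by rewrite subr_gt0.
    have [_ _ /(_ _ Dy)[w wW yw]] := netP j.
    exists w; last first.
      by rewrite rdistC; have := ler_rdistD y x w; lra.
    apply/flattenP; exists (E j); last exact: net_in_orbits.
    by apply: map_f; rewrite mem_iota add0n ltnSn.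
  exists x; last by rewrite rdist0.
  apply/flattenP; exists (E i) => //.
  by apply: map_f; rewrite mem_iota add0n ltnS (ltnW ij).
Qed.

(** A limit point outside the closure of some [D j] belongs to the finite set of levels below [j],
    because that set together with the closure is closed and contains [M]. *)
Lemma attractor_closed : closed M.
Proof.
move=> x Mx; apply: contrapT => /not_orP[/existsNP[j /not_implyP[_ xDj]] xE].
have clC : closed (closure (D j) `|` [set` flatten [seq E i | i <- iota 0 j]]).
  apply: closedU; first exact: closed_closure.
  apply: accessible_finite_set_closed.1; last exact: finite_seq.
  by apply: hausdorff_accessible; exact: norm_hausdorff.
have : (closure (D j) `|` [set` flatten [seq E i | i <- iota 0 j]]) x.
  apply: clC; apply: closureS Mx.
  move=> y /(attractor_sub_closure j)[|[i ij yE]]; first by left.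
  right => /=; apply/flattenP; exists (E i) => //.
  by apply: map_f; rewrite mem_iota.
move=> [//|/= /flattenP[_ /mapP[i _ ->] xEi]].
by apply: xE; exists i.
Qed.

Lemma attractor_compact : compact M.
Proof.
rewrite compact_ultra => F UF FM.
(* An ultrafilter containing a finite union contains one of its members; with the finite covers of
   [M] this makes [F] Cauchy. *)
have ultra_seq (s : seq X) (A : X -> set X) :
    F [set y | exists2 c, c \in s & A c y] -> exists c, F (A c).
  elim: s => [|c s IHs] Fs.
    by have [y []] := @filter_ex _ F _ _ Fs.
  have [|FAc] := in_ultra_setVsetC (A c) UF; first by exists c.
  apply: IHs; apply: filterS2 Fs FAc => y [c' + Ac'y] nAcy.
  by rewrite inE => /orP[/eqP c'c|c's]; [rewrite c'c in Ac'y|exists c'].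
have [|x Fx] := @cauchy_rnormP R k X F _ _.
  move=> e e0.
  have [j _ /(_ j (leqnn j)) je] := near_geometric_lt theta01 d0 e0.
  have [s [_ _ s_cov]] := attractor_cover je.
  apply: (ultra_seq s (fun c => [set y | rnorm (c - y) < e])).
  by apply: filterS FM => y /s_cov.
exists x; split=> //; apply: attractor_closed => U /Fx FU.
by have [y] := @filter_ex _ F _ _ (filterI FM FU); exists y.
Qed.

(** Each [y j] is within [theta ^+ j * d] of a net point, and net points lie in the compact [M]. The
    condition [j <= g j] stands in for a strictly increasing [g]. *)
Lemma omega_limit_subseq (y : nat -> X) (m : nat -> nat) :
  (forall j, j <= m j)%N -> (forall j, D (m j) (y j)) ->
  exists x (g : nat -> nat), [/\ omega_limit f B x, forall j, (j <= g j)%N &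
    (y \o g) @ \oo --> x].
Proof.
move=> jm Dy.
have theta_anti i j : (i <= j)%N -> theta ^+ j * d <= theta ^+ i * d.
  by move=> ij; case/andP: theta01 => ? ?; rewrite ler_pM2r// ler_wiXn2l ?ltW.
have /choice[w wP] : forall j, exists w,
    w \in W (m j) /\ rnorm (y j - w) <= theta ^+ j * d.
  move=> j; have [_ _ /(_ _ (Dy j))[w wW yw]] := netP (m j).
  by exists w; split=> //; apply: le_trans yw _; exact: theta_anti.
have Mw j : M (w j).
  by apply/(@orbits_sub_attractor (m j))/net_in_orbits; have [] := wP j.
have [|x [Mx x_cluster]] := attractor_compact (F := w @ \oo).
  by exists 0%N => // j _; exact: Mw.
have /choice[g gP] : forall j, exists i,
    (j <= i)%N /\ rnorm (x - w i) < j.+1%:R^-1.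
  move=> j; have [||z [[i ji <-] /=]] := x_cluster
    [set w i | i in [set i | (j <= i)%N]] [set z | rnorm (x - z) < j.+1%:R^-1].
  - by exists j => // i ji; exists i.
  - by apply/nbhs_rnormP; exists j.+1%:R^-1; rewrite ?invr_gt0.
  - by exists i.
have xy : (y \o g) @ \oo --> x.
  apply/cvg_rnormP => e e0.
  have e20 : 0 < e / 2 by rewrite divr_gt0.
  have th := near_geometric_lt theta01 d0 e20.
  have inv := near_infty_natSinv_lt (PosNum e20).
  near=> j.
  have jth : theta ^+ j * d < e / 2 by near: j.
  have jinv : j.+1%:R^-1 < e / 2 :> R by near: j.
  have [jg xw] := gP j; have [_ yw] := wP (g j).
  have := ler_rdistD (w (g j)) x (y (g j)); rewrite (rdistC (w _)) /=.
  have := theta_anti _ _ jg; have := lt_trans xw jinv; lra.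
exists x, g; split=> //; last by move=> j; have [] := gP j.
move=> i _; apply/closure_rnormP => e e0.
have /cvg_rnormP/(_ e e0)[j0 _ j0P] := xy.
have := j0P (maxn i j0) (leq_maxr _ _); exists (y (g (maxn i j0))) => //.
apply: iter_image_anti (Dy _); apply: leq_trans (jm _).
by have [ig _] := gP (maxn i j0); exact: leq_trans (leq_maxl _ _) ig.
Unshelve. all: by end_near. Qed.

End NetAttractor.

(** * Fractal dimension *)

(** For the least admissible [j], [e <= theta ^+ (j - 1) * d], so [j] is at most
    [ln e^-1 / ln theta^-1] up to a constant. The polynomial factor adds only [2 * ln (j + 1)],
    which [delta] absorbs. *)
Lemma log_count_estimate (R : realType) (theta d Q delta : R) :
  0 < theta < 1 -> 0 < d -> 1 <= Q -> 0 < delta ->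
  exists2 e1, 0 < e1 & forall e, 0 < e < e1 ->
    0 < ln e^-1 /\ exists2 j, theta ^+ j * d < e &
      ln (j.+1%:R ^+ 2 * Q ^+ j) <= (ln Q / ln theta^-1 + delta) * ln e^-1.
Proof.
move=> theta01 d0 Q1 delta0; have /andP[theta0 theta1] := theta01.
set a := ln theta^-1; set b := ln Q.
have a0 : 0 < a by rewrite ln_gt0// invf_gt1.
have b0 : 0 <= b by rewrite ln_ge0.
(* Half of [delta] pays for the slope [del] of the logarithmic term, as [del / a = delta / 2]; the
   other half pays for the constant [C2]. *)
pose del := a * delta / 2.
have del0 : 0 < del by rewrite divr_gt0// mulr_gt0.
have ln_succ (j : nat) :
    2 * ln (j.+1%:R : R) <= del * j%:R + (del - 2 * ln (del / 2)).
  have j0 : 0 < j.+1%:R :> R by [].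
  have dj0 : 0 < del / 2 by rewrite divr_gt0.
  have /ltW le_ln := ln_sublinear (mulr_gt0 dj0 j0).
  rewrite lnM ?posrE// in le_ln.
  have -> : del * j%:R + (del - 2 * ln (del / 2))
      = 2 * (del / 2 * j.+1%:R - ln (del / 2)) by rewrite -natr1; field.
  rewrite ler_pM2l//; lra.
set C := del - _ in ln_succ.
pose C2 := (b + del) * (ln d / a + 1) + C.
exists (Num.min d (Num.min 1 (expR (- (2 * C2 / delta))))).
  by rewrite !lt_min d0 ltr01 expR_gt0.
move=> e /andP[e0]; rewrite !lt_min => /and3P[ed e1 eC2].
have L_C2 : 2 * C2 / delta < ln e^-1.
  by rewrite lnV ?posrE// ltrNr -ltr_expR lnK.
have L0 : 0 < ln e^-1 by rewrite ln_gt0// invf_gt1.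
split=> //; have ex_j : exists j, theta ^+ j * d < e.
  have [j _ /(_ j (leqnn j)) je] := near_geometric_lt theta01 d0 e0.
  by exists j.
(* The least [j] is positive because [e < d], so its predecessor gives an upper bound on [e]. *)
have [[|i] ie i_min] := ex_minnP ex_j.
  by move: ie; rewrite expr0 mul1r ltNge (ltW ed).
exists i.+1 => //.
have ei : e <= theta ^+ i * d.
  by rewrite leNgt; apply/negP => /i_min; rewrite ltnn.
have iL : i%:R * a <= ln d + ln e^-1.
  have thi0 : 0 < theta ^+ i by rewrite exprn_gt0.
  have : ln e <= ln (theta ^+ i * d) by rewrite ler_ln ?posrE// mulr_gt0.
  rewrite lnM ?posrE// lnXn// /a !lnV ?posrE// -mulr_natl; lra.
have Qi0 : 0 < Q by exact: lt_le_trans ltr01 Q1.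
rewrite lnM ?posrE ?exprn_gt0// !lnXn// -/b.
rewrite -[b *+ _]mulr_natr -[_ *+ 2]mulr_natl.
have := ln_succ i.+1.
have iL' : i%:R <= (ln d + ln e^-1) / a by rewrite ler_pdivlMr.
have bi : (b + del) * i.+1%:R <= (b + del) * ((ln d + ln e^-1) / a + 1).
  by rewrite ler_wpM2l ?addr_ge0 ?(ltW del0)// -natr1 lerD2r.
have C2L : C2 <= delta / 2 * ln e^-1.
  by move: L_C2; rewrite ltr_pdivrMr//; lra.
have split_bound : (b + del) * ((ln d + ln e^-1) / a + 1) + C
    = (b / a + delta / 2) * ln e^-1 + C2.
  by rewrite /C2 /del; field; rewrite gt_eqF.
move: bi C2L split_bound; rewrite mulrDl; lra.
Qed.

Lemma fractal_dim_le (R : realType) (k : scalar_kind)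
    (X : normedModType (scalar_field R k)) (G : set X) (theta d Q : R) :
  0 < theta < 1 -> 0 < d -> 1 <= Q ->
  (forall j e, theta ^+ j * d < e ->
     exists s : seq X, [/\ (size s)%:R <= j.+1%:R ^+ 2 * Q ^+ j,
       forall c, c \in s -> G c &
       forall x, G x -> exists2 c, c \in s & rnorm (c - x) < e]) ->
  (fractal_dim G <= (ln Q / ln theta^-1)%:E)%E.
Proof.
move=> theta01 d0 Q1 coverG; apply/lee_addgt0Pr => delta delta0.
have [e1 e10 estimate] := log_count_estimate theta01 d0 Q1 delta0.
rewrite -EFinD; set c := _ + _.
apply: (@le_trans _ _ (ereal_sup
    ((fun e : R => lne (covering_number G e) * ((ln e^-1)^-1)%:E)%E
      @` `]0, e1[))).
  apply: ereal_inf_lbound => /=; exists `]0, e1[%classic => //.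
  near=> e; rewrite /= in_itv /=; apply/andP; split; near: e.
    exact: nbhs_right_gt.
  exact: nbhs_right_lt.
apply: ge_ereal_sup => _ [e /= ee1 <-].
have [|L0 [j je ln_le]] := estimate e; first by move: ee1; rewrite in_itv.
have [s [s_le sG s_cov]] := coverG j e je.
have r0 : 0 < j.+1%:R ^+ 2 * Q ^+ j.
  by rewrite mulr_gt0 ?exprn_gt0// (lt_le_trans ltr01).
have N0 : (0 <= covering_number G e)%E.
  by apply: le_ereal_inf_tmp => _ [l _ <-]; rewrite lee_fin.
have NQ : (covering_number G e <= (j.+1%:R ^+ 2 * Q ^+ j)%:E)%E.
  apply: (@le_trans _ _ (size s)%:R%:E); last by rewrite lee_fin.
  by apply: ereal_inf_lbound; exists s.
apply: (@le_trans _ _ ((ln (j.+1%:R ^+ 2 * Q ^+ j))%:E * ((ln e^-1)^-1)%:E)%E).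
  apply: lee_wpmul2r; first by rewrite lee_fin invr_ge0 ltW.
  by rewrite -lne_EFin// lee_lne ?in_itv/= ?N0 ?leey// lee_fin ltW.
by rewrite -EFinM lee_fin ler_pdivrMr.
Unshelve. all: by end_near. Qed.

(** * Attraction along the semigroup *)

Lemma cvge0_squeeze (R : realType) (T : Type) (F : set_system T)
    (u : T -> \bar R) :
  Filter F -> (forall t, 0 <= u t)%E ->
  (forall e : R, 0 < e -> \forall t \near F, (u t <= e%:E)%E) ->
  u @ F --> 0%E.
Proof.
move=> FF u0 ue; apply/fine_cvgP; split.
  by apply: filterS (ue _ ltr01) => t; move: (u0 t); case: (u t).
apply/cvgrPdist_le => e e0; apply: filterS (ue _ e0) => t /=.
rewrite sub0r normrN; move: (u0 t); case: (u t) => //= r.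
by rewrite !lee_fin => r0 re; rewrite ger0_norm.
Qed.

Section SemidistSubseq.
Variables (R : realType) (k : scalar_kind) (X : normedModType (scalar_field R k)).
Implicit Types (G H : set X) (u : nat -> X).

Lemma semidist_ge0 G H : (0 <= semidist G H)%E.
Proof. by rewrite /semidist le_max lexx. Qed.

Lemma semidist_le G H (e : R) : 0 <= e ->
  (forall x, G x -> exists2 y, H y & rnorm (x - y) <= e) ->
  (semidist G H <= e%:E)%E.
Proof.
move=> e0 GH; rewrite /semidist ge_max lee_fin e0 /=.
apply: ge_ereal_sup => _ [x Gx <-]; have [y Hy xy] := GH x Gx.
apply: (@le_trans _ _ (metric x y)%:E); last by rewrite lee_fin.
by apply: ereal_inf_lbound; exists y.
Qed.

Lemma cvg_nat_subseq u (h : nat -> nat) (x : X) :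
  (forall i, i <= h i)%N -> u @ \oo --> x -> (u \o h) @ \oo --> x.
Proof.
move=> ih /cvg_rnormP ux; apply/cvg_rnormP => e /ux [i0 _ i0P].
by exists i0 => // i /= i0i; apply: i0P; exact: leq_trans (ih i).
Qed.

End SemidistSubseq.

Section TimeSet.
Variables (R : realType) (time : time_kind).
Local Notation I := (time_set R time).

Lemma time_set_ge0 t : I t -> 0 <= t.
Proof. by case: time => //= -[m _ <-]. Qed.

Lemma time_set0 : I 0.
Proof. by case: time => //=; exists 0%N. Qed.

Lemma time_setD s t : I s -> I t -> I (s + t).
Proof.
case: time => /= [|[m _ <-] [n _ <-]]; first exact: addr_ge0.
by exists (m + n)%N; rewrite // natrD.
Qed.

Lemma time_setB s t : I s -> I t -> s <= t -> I (t - s).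
Proof.
case: time => /= [_ _|[m _ <-] [n _ <-]]; first by rewrite subr_ge0.
by rewrite ler_nat => mn; exists (n - m)%N; rewrite // natrB.
Qed.

Lemma time_set_muln (j : nat) t : I t -> I (j%:R * t).
Proof.
move=> It; elim: j => [|j IHj]; first by rewrite mul0r; exact: time_set0.
by rewrite -natr1 mulrDl mul1r; exact: time_setD.
Qed.

End TimeSet.

(* [B] need not be forward invariant: [S t B] is inside [B] only for large [t]. *)
Definition forward_core (R : realType) (X : Type) (S : R -> X -> X) (T : R)
    (B : set X) : set X :=
  [set x | B x /\ forall j : nat, B (S (j%:R * T) x)].

(** * Dynamics on the forward core *)

Section Dynamics.
Variables (R : realType) (k : scalar_kind) (time : time_kind).
Variables (X : completeNormedModType (scalar_field R k)) (V : set X).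
Variables (S : R -> X -> X) (B : set X) (T : R).
Local Notation I := (time_set R time).
Hypotheses (V_neq0 : V !=set0) (V_closed : closed V) (S_semi : semigroup I V S).
Hypotheses (B_bounded : bounded_set B) (B_abs : absorbing I V S B).
Hypotheses (IT : I T) (T0 : 0 < T).

Let f := S T.
Let B0 := forward_core S T B.
Let D j : set X := iter j f @` B0.

Lemma forward_core_sub : B0 `<=` B. Proof. by move=> x []. Qed.

Lemma forward_core_subV : B0 `<=` V.
Proof. by move=> x [/(B_abs.1)]. Qed.

Lemma iter_semigroup j x : V x -> iter j f x = S (j%:R * T) x.
Proof.
have [SV S0 SD] := S_semi => Vx.
elim: j => [|j IHj] /=; first by rewrite mul0r S0.
rewrite IHj /f SD//; last exact: time_set_muln.
by rewrite -natr1 mulrDl mul1r addrC.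
Qed.

Lemma forward_core_invariant : f @` B0 `<=` B0.
Proof.
have [SV S0 SD] := S_semi.
move=> _ [x [Bx Bjx] <-]; have Vx := B_abs.1 _ Bx.
split; first by have := Bjx 1%N; rewrite mul1r.
move=> j; rewrite /f SD//; last exact: time_set_muln.
by have := Bjx j.+1; rewrite -natr1 mulrDl mul1r.
Qed.

(** At time [t - j T >= tG] the orbit has entered [B] for good, so the point reached there is in the
    core; [j] further steps of length [T] lead to [S t x]. *)
Lemma forward_core_absorbs G : G `<=` V -> bounded_set G ->
  exists2 tG, I tG &
    forall t j x, I t -> G x -> tG + j%:R * T <= t -> D j (S t x).
Proof.
have [SV S0 SD] := S_semi => GV /(B_abs.2 _ GV)[tG ItG tGP].
exists tG => // t j x It Gx tGt.
have jT0 : 0 <= j%:R * T by rewrite mulr_ge0// ltW.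
have tG0 := time_set_ge0 ItG.
have IjT : I (j%:R * T) by exact: time_set_muln.
have Itj : I (t - j%:R * T).
  by apply: time_setB => //; lra.
have Vx := GV _ Gx.
have coreP : B0 (S (t - j%:R * T) x).
  split; first by apply: (tGP _ Itj); [lra|exists x].
  move=> i; have IiT : I (i%:R * T) by exact: time_set_muln.
  rewrite SD//; apply: (tGP (i%:R * T + (t - j%:R * T))); last by exists x.
    exact: time_setD.
  by have := time_set_ge0 IiT; lra.
exists (S (t - j%:R * T) x) => //.
by rewrite iter_semigroup ?SD// ?subrKC//; exact: SV.
Qed.

Lemma forward_core_neq0 : B0 !=set0.
Proof.
have [v Vv] := V_neq0.
have [||tG ItG tGP] := @forward_core_absorbs [set v].
- by move=> _ ->.
- by apply/bounded_setP; exists (rnorm v) => _ ->.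
have [|x Bx _] := tGP tG 0%N v ItG erefl; last by exists x.
by rewrite mul0r addr0.
Qed.

Variables (W : nat -> seq X) (theta d Q L : R).
Hypotheses (theta01 : 0 < theta < 1) (d0 : 0 < d) (Q1 : 1 <= Q).
Hypothesis netP : forall j,
  [/\ (size (W j))%:R <= Q ^+ j, forall w, w \in W j -> (iter j f @` B0) w &
      forall x, (iter j f @` B0) x ->
        exists2 w, w \in W j & rnorm (x - w) <= theta ^+ j * d].
Hypothesis L0 : 0 < L.
Hypothesis f_lipschitz : forall x y, B x -> B y ->
  rnorm (f x - f y) <= L * rnorm (x - y).

Let M := net_attractor f B0 W.
Let A := omega_limit f B0.

Let subseq := omega_limit_subseq theta01 d0 Q1 forward_core_invariant netP.

Lemma net_attractor_exp_attracts : exists2 xi : R, 0 < xi &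
  forall G : set X, G `<=` V -> bounded_set G ->
    ((expR (xi * t))%:E * semidist (S t @` G) M)%E
      @[t --> within I +oo] --> 0%E.
Proof.
have /andP[theta0 theta1] := theta01.
pose a := ln theta^-1.
have a0 : 0 < a by rewrite ln_gt0// invf_gt1.
have theta_exp j : theta ^+ j = expR (- (j%:R * a)).
  by rewrite /a lnV ?posrE// mulrN opprK expRM_natl lnK ?posrE.
(* Half of the decay rate [a / T] of the mesh; the other half drives the weighted distance to
   [0]. *)
pose xi := a / (2 * T).
have xi0 : 0 < xi by rewrite divr_gt0// mulr_gt0.
exists xi => // G GV G_bounded.
have [tG ItG tGP] := forward_core_absorbs GV G_bounded.
(* The exponent accounts for the delay [tG] and for rounding [(t - tG) / T] down to an integer. *)
pose K := d * expR (a * (tG / T + 1)).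
have K0 : 0 < K by rewrite mulr_gt0// expR_gt0.
have dist_le t : I t -> tG <= t ->
    (semidist (S t @` G) M <= (K * expR (- (2 * xi * t)))%:E)%E.
  move=> It tGt; pose z := (t - tG) / T.
  have z0 : 0 <= z by rewrite divr_ge0 ?subr_ge0// ltW.
  have /andP[jz zj] := truncn_itv z0.
  set j := Num.truncn z in jz zj.
  apply: (@le_trans _ _ (theta ^+ j * d)%:E).
    apply: semidist_le; first by rewrite mulr_ge0 ?exprn_ge0 ?ltW.
    move=> _ [x Gx <-].
    have [_ _ /(_ (S t x))] := netP j.
    case=> [|w wW xw].
      apply: tGP => //; move: jz; rewrite ler_pdivlMr//; lra.
    by exists w => //; right; exists j; exact: net_in_orbits.
  rewrite lee_fin theta_exp mulrC /K -mulrA ler_pM2l// -expRD ler_expR.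
  have -> : a * (tG / T + 1) - 2 * xi * t = - ((z - 1) * a).
    by rewrite /xi /z; field; rewrite gt_eqF.
  by rewrite lerN2 ler_pM2r// lerBlDr natr1 ltW.
apply: cvge0_squeeze => [t|e e0].
  by rewrite mule_ge0 ?semidist_ge0// lee_fin expR_ge0.
exists (Num.max tG (- (ln (e / K) / xi))); split; first exact: num_real.
move=> t; rewrite gt_max => /andP[tGt et] It.
apply: (@le_trans _ _ ((expR (xi * t))%:E * (K * expR (- (2 * xi * t)))%:E)%E).
  apply: lee_wpmul2l; first by rewrite lee_fin expR_ge0.
  by apply: dist_le => //; exact: ltW.
rewrite -EFinM lee_fin mulrCA -expRD mulrC -ler_pdivlMr//.
rewrite -[leRHS]lnK ?posrE ?divr_gt0// ler_expR.
move: et; rewrite ltrNl ltr_pdivlMr// => /ltW; lra.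
Qed.

Lemma net_attractor_neq0 : M !=set0.
Proof.
have [x Bx] := forward_core_neq0.
have [_ _ /(_ x)[|w wW _]] := netP 0%N; first by exists x.
by exists w; right; exists 0%N.
Qed.

Lemma omega_limit_subV : A `<=` V.
Proof.
move=> x /(_ 0%N Logic.I) Ax; apply: V_closed; apply: closureS Ax.
by move=> _ [y By <-]; exact: forward_core_subV.
Qed.

Lemma omega_limit_bounded : bounded_set A.
Proof.
have /bounded_setP[r Br] := B_bounded.
apply/bounded_setP; exists (r + 1) => x /(_ 0%N Logic.I).
move=> /closure_rnormP/(_ 1 ltr01)[_ [y By <-] /=] xy.
have := Br _ (forward_core_sub By); have := ler_rnormD (x - y) y.
by rewrite subrK; lra.
Qed.

Lemma net_attractor_sub : A `<=` B -> M `<=` B.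
Proof.
move=> AB x [/AB//|[j xE]]; apply: forward_core_sub.
have [y By <-] := net_orbits_sub netP xE.
elim: j {xE} => //= j IHj.
by apply: forward_core_invariant; exists (iter j f y).
Qed.

(** The net orbits move up one level. On the omega-limit set the Lipschitz bound, available on [B],
    carries approximating points along. *)
Lemma net_attractor_forward : A `<=` B -> f @` M `<=` M.
Proof.
move=> AB _ [x [Ax|[j xE]] <-]; last first.
  right; exists j.+1 => /=; rewrite mem_cat; apply/orP; right; exact: map_f.
left=> j _; apply/closure_rnormP => e e0.
have /closure_rnormP/(_ (e / L))[|y Dy xy] := Ax j Logic.I.
  exact: divr_gt0.
have [z z_core zy] := iter_image_anti forward_core_invariant (leq0n j) Dy.
have By : B y by rewrite -zy; exact: forward_core_sub.
have [z' z'_core z'y] := Dy.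
exists (f y).
  apply: (iter_image_anti forward_core_invariant (leqnSn j)).
  by exists z' => //=; rewrite z'y.
apply: le_lt_trans (f_lipschitz (AB _ Ax) By) _.
by rewrite mulrC -ltr_pdivlMr.
Qed.

Lemma omega_limit_attracts G : G `<=` V -> bounded_set G ->
  semidist (S t @` G) A @[t --> within I +oo] --> 0%E.
Proof.
move=> GV /(forward_core_absorbs GV)[tG ItG tGP].
apply: cvge0_squeeze => [t|e e0]; first exact: semidist_ge0.
(* Otherwise points of [D j] farther than [e] from [A] would exist for every [j], and a subsequence
   would converge into [A]. *)
have [j jP] : exists j, forall y, D j y -> exists2 z, A z & rnorm (y - z) <= e.
  apply: contrapT => /forallNP far.
  have /choice[y yP] : forall j, exists y,
      D j y /\ forall z, A z -> e < rnorm (y - z).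
    move=> j; have /existsNP[y /not_implyP[Dy yA]] := far j.
    exists y; split=> // z Az; rewrite ltNge; apply/negP => yz.
    by apply: yA; exists z.
  have [|x [g [Ax _ /cvg_rnormP/(_ e e0)[i _ /(_ i (leqnn i)) /=]]]] :=
    subseq (y := y) (fun j => leqnn j).
    by move=> j; have [] := yP j.
  have [_ /(_ x Ax)] := yP (g i).
  by rewrite rdistC => /lt_trans h /h; rewrite ltxx.
exists (tG + j%:R * T); split; first exact: num_real.
move=> t /ltW tGt It; apply: semidist_le; first exact: ltW.
by move=> _ [x Gx <-]; apply: jP; exact: tGP.
Qed.

(** * Invariance of the omega-limit set and the global attractor *)

Section AsymptoticallyClosed.
Hypothesis S_closed : asymptotically_closed I V S.

Lemma omega_limit_seq x : A x -> exists b : nat -> X,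
  (forall j, B0 (b j)) /\ (fun j : nat => S (j%:R * T) (b j)) @ \oo --> x.
Proof.
move=> Ax.
have /choice[b bP] : forall j : nat, exists b, B0 b /\
    rnorm (x - S (j%:R * T) b) < j.+1%:R^-1.
  move=> j.
  have /closure_rnormP/(_ j.+1%:R^-1)[|_ [b Bb <-] xb] := Ax j Logic.I.
    by rewrite invr_gt0.
  exists b; split=> //; rewrite -iter_semigroup//; exact: forward_core_subV.
exists b; split=> [j|]; first by have [] := bP j.
apply/cvg_rnormP => e e0; have inv := near_infty_natSinv_lt (PosNum e0).
by apply: filterS inv => j /(lt_trans (bP j).2).
Qed.

(** The [p] extra steps cover [t] plus the absorption time of the core, so moving by [t] forward or
    backward from time [(j + p) T] still lands in [D j]. The two directions serve the two inclusions
    of invariance. *)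
Lemma forward_core_shift t : I t -> exists p : nat, forall j b, B0 b ->
  [/\ D j (S (t + (j + p)%:R * T) b), I ((j + p)%:R * T - t) &
      D j (S ((j + p)%:R * T - t) b)].
Proof.
move=> It; have t0 := time_set_ge0 It.
have core_bounded : bounded_set B0.
  have /bounded_setP[r Br] := B_bounded.
  by apply/bounded_setP; exists r => x /forward_core_sub /Br.
have [tB ItB tBP] := forward_core_absorbs forward_core_subV core_bounded.
exists (Num.truncn ((tB + t) / T)).+1 => j b Bb; set p := _.+1.
have pT : tB + t <= p%:R * T.
  by rewrite -ler_pdivrMr//; apply: ltW; exact: truncnS_gt.
have IpT : I ((j + p)%:R * T) by exact: time_set_muln.
have jT0 : 0 <= j%:R * T by rewrite mulr_ge0// ltW.
have tB0 := time_set_ge0 ItB.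
have IpTt : I ((j + p)%:R * T - t).
  by apply: time_setB => //; rewrite natrD mulrDl; lra.
split=> //; apply: tBP => //; first exact: time_setD.
  by rewrite natrD mulrDl; lra.
by rewrite natrD mulrDl; lra.
Qed.

Let cvg_times (h : nat -> nat) (t : R) : (forall i, (i <= h i)%N) ->
  (fun i => (h i)%:R * T - t) @ \oo --> +oo.
Proof.
move=> ih; apply/cvgryPge => c.
exists (Num.truncn ((c + t) / T)).+1 => // i /= i_ge.
rewrite lerBrDr -ler_pdivrMr//; apply: le_trans (ltW (truncnS_gt _)) _.
by rewrite ler_nat; exact: leq_trans (ih i).
Qed.

Lemma omega_limit_invariant t : I t -> S t @` A = A.
Proof.
move=> It; have [p pP] := forward_core_shift It.
have bounded_core_seq (b : nat -> X) :
    (forall i, B0 (b i)) -> bounded_set (range b).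
  have /bounded_setP[r Br] := B_bounded.
  move=> Bb; apply/bounded_setP; exists r => _ [i _ <-].
  by apply: Br; exact: forward_core_sub.
rewrite eqEsubset; split.
  (* Forward inclusion: orbits that approach [x], run for a further time [t], subconverge to some
     [z] in [A], and asymptotic closedness identifies [z] with [S t x]. *)
  move=> _ [x Ax <-]; have [b [Bb bx]] := omega_limit_seq Ax.
  have [|z [g [Az ig yz]]] := subseq
      (y := fun j => S (t + (j + p)%:R * T) (b (j + p)%N)) (fun j => leqnn j).
    by move=> j; have [] := pP j _ (Bb (j + p)%N).
  suff -> : S t x = z by [].
  have ih i : (i <= g i + p)%N by rewrite (leq_trans (ig i))// leq_addr.
  apply: (S_closed (t_ := fun i => (g i + p)%:R * T)
    (x_ := fun i => b (g i + p)%N)) => //.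
  - by move=> i; exact: time_set_muln.
  - by have := cvg_times 0 ih; under eq_fun do rewrite subr0.
  - by move=> i; exact: forward_core_subV.
  - exact: bounded_core_seq.
  - exact: omega_limit_subV.
  - exact: omega_limit_subV.
  - exact: (cvg_nat_subseq ih bx).
(* Backward inclusion: the same orbits, stopped a time [t] earlier, subconverge to a preimage of [x]
   in [A]. *)
move=> x Ax; have [b [Bb bx]] := omega_limit_seq Ax.
have [|z [g [Az ig yz]]] := subseq
    (y := fun j => S ((j + p)%:R * T - t) (b (j + p)%N)) (fun j => leqnn j).
  by move=> j; have [] := pP j _ (Bb (j + p)%N).
exists z => //.
have ih i : (i <= g i + p)%N by rewrite (leq_trans (ig i))// leq_addr.
apply: (S_closed (t_ := fun i => (g i + p)%:R * T - t)
  (x_ := fun i => b (g i + p)%N)) => //.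
- by move=> i; have [] := pP (g i) _ (Bb (g i)).
- exact: cvg_times.
- by move=> i; exact: forward_core_subV.
- exact: bounded_core_seq.
- exact: omega_limit_subV.
- exact: omega_limit_subV.
- by under eq_fun do rewrite subrKC; exact: (cvg_nat_subseq ih bx).
Qed.

(** [A] is bounded, so some [S tA] sends it into [B], while invariance says that [S tA] maps [A]
    onto itself. *)
Lemma omega_limit_sub : A `<=` B.
Proof.
have [tA ItA tAP] := B_abs.2 _ omega_limit_subV omega_limit_bounded.
by rewrite -(omega_limit_invariant ItA); exact: tAP.
Qed.

Lemma omega_limit_global_attractor : global_attractor I V S A.
Proof.
split.
- exact: omega_limit_subV.
- have [v Bv] := forward_core_neq0.
  have [|x [_ [Ax _ _]]] :=
    subseq (y := fun j => iter j f v) (fun j => leqnn j).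
    by move=> j; exists v.
  by exists x.
- apply: (@subclosed_compact _ _ M).
  + by apply: closed_bigI => j _; exact: closed_closure.
  + exact: (attractor_compact theta01 d0 Q1 forward_core_invariant netP).
  + by move=> x; left.
- exact: omega_limit_invariant.
- exact: omega_limit_attracts.
Qed.

End AsymptoticallyClosed.

End Dynamics.

(** * Assembly of the exponential and global attractors *)

Theorem theorem6p5 (R : realType) (K : scalar_kind) (time : time_kind)
    (X : completeNormedModType (scalar_field R K)) (V : set X) (S : R -> X -> X)
    (B : set X) (T : R) (n : nat) (eta mu kappa : R)
    (Xn : normedModType (scalar_field R K)) (P : X -> Xn) :
  V !=set0 -> closed V ->
  semigroup (time_set R time) V S ->
  bounded_set B -> absorbing (time_set R time) V S B ->
  asymptotically_closed (time_set R time) V S \/ closed B ->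
  time_set R time T -> 0 < T ->
  generalized_squeezing S B T n eta mu kappa P ->
  forall sigma : R, 0 < sigma < 1 - eta ->
  exists M0 : set X,
    [/\ M0 `<=` B,
        discrete_exponential_attractor (time_set R time) V S T M0,
        (fractal_dim M0 <=
          ((real_multiplicity K n)%:R *
           (ln (1 + 2 * kappa * mu * dBM n Xn / sigma) /
            ln ((eta + sigma)^-1)))%:E)%E &
        asymptotically_closed (time_set R time) V S ->
        exists2 A : set X,
          global_attractor (time_set R time) V S A & A `<=` M0].
Proof.
move=> V_neq0 V_closed S_semi B_bounded B_abs AC_or_closed IT T0 squeeze sigma.
move=> /andP[sigma0 sigma1].
have [[n0 dimXn] /andP[eta0 eta1] mu0 kappa0 squeezeP] := squeeze.
pose theta := eta + sigma.
have theta0 : 0 < theta by rewrite ltr_wpDl.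
have theta01 : 0 < theta < 1 by rewrite theta0 /theta; lra.
have [r Br] := (bounded_setP B).1 B_bounded.
pose d := 2 * `|r| + 1.
have d0 : 0 < d by rewrite ltr_wpDl// mulr_ge0.
pose q := 1 + 2 * kappa * mu / sigma.
have kms0 : 0 < 2 * kappa * mu / sigma by rewrite divr_gt0// !mulr_gt0.
have q1 : 1 <= q by rewrite lerDl ltW.
pose Q := q ^+ real_multiplicity K n.
have Q1 : 1 <= Q by exact: exprn_ege1.
have core_inv := forward_core_invariant S_semi B_abs IT.
have core_sub : forward_core S T B `<=` B by move=> x [].
have core_diam : diam_le (forward_core S T B) d.
  move=> x y /core_sub /Br xr /core_sub /Br yr.
  have := ler_rnormD x (- y); rewrite rnormN; have := ler_norm r.
  by rewrite /d; lra.
have [W netP] := @iterated_net R K X (S T) (forward_core S T B) theta d Q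
  theta0 d0 (le_trans ler01 Q1) core_inv core_diam
  (fun A d' AB d'0 A_diam => squeezing_cover squeeze sigma0
    (subset_trans AB core_sub) d'0 A_diam).
have L0 : 0 < eta + mu * kappa by rewrite ltr_wpDl// mulr_gt0.
have lipschitz x y : B x -> B y ->
    rnorm (S T x - S T y) <= (eta + mu * kappa) * rnorm (x - y).
  move=> Bx By; have [le1 le2] := squeezeP x y Bx By.
  apply: le_trans le1 _; rewrite mulrDl lerD2l -mulrA.
  by rewrite ler_wpM2l// ltW.
pose M0 := net_attractor (S T) (forward_core S T B) W.
(* Asymptotic closedness gives this through invariance; a closed [B] gives it because the
   omega-limit set lies in the closure of the core. *)
have omega_sub : omega_limit (S T) (forward_core S T B) `<=` B.
  case: AC_or_closed => [AC|B_closed].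
    exact: (omega_limit_sub V_closed S_semi B_bounded B_abs IT T0
      theta01 d0 Q1 netP AC).
  move=> x /(_ 0%N Logic.I) Ax; apply: B_closed; apply: closureS Ax.
  by move=> _ [y By <-]; exact: core_sub.
have M0_sub := net_attractor_sub S_semi B_abs IT netP omega_sub.
have dim_le : (fractal_dim M0 <= (ln Q / ln theta^-1)%:E)%E.
  apply: (fractal_dim_le theta01 d0 Q1) => j e je.
  exact: (attractor_cover theta01 d0 Q1 core_inv netP je).
exists M0; split=> //.
- split.
  + split; first by move=> x /M0_sub; exact: B_abs.1.
    exact: (net_attractor_neq0 V_neq0 S_semi B_abs IT T0 netP).
  + exact: (attractor_compact theta01 d0 Q1 core_inv netP).
  + exact: (net_attractor_forward S_semi B_abs IT L0 lipschitz omega_sub).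
  + by apply: le_lt_trans dim_le _; rewrite ltry.
  + exact: (net_attractor_exp_attracts S_semi B_abs IT T0 theta01 d0 netP).
- apply: le_trans dim_le _; rewrite lee_fin mulrA.
  have dBM1 : 1 <= dBM n Xn by exact: dBM_ge1.
  have lntheta0 : 0 < ln theta^-1.
    by rewrite ln_gt0// invf_gt1; case/andP: theta01.
  rewrite ler_pM2r ?invr_gt0// /Q lnXn ?(lt_le_trans ltr01)// -[leLHS]mulr_natl.
  rewrite ler_wpM2l// ler_ln ?posrE ?(lt_le_trans ltr01 q1)//.
    rewrite /q lerD2l [leRHS]mulrAC ler_peMr ?(ltW kms0)//; exact: dBM1.
  rewrite ltr_wpDr// mulrAC mulr_ge0 ?(ltW kms0)//.
  exact: le_trans ler01 dBM1.
- move=> AC; exists (omega_limit (S T) (forward_core S T B)).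
  2: by left.
  exact: (omega_limit_global_attractor V_neq0 V_closed S_semi B_bounded B_abs
    IT T0 theta01 d0 Q1 netP AC).
Qed.
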